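(* Let $\phi=\tilde p/p$ be an irreducible rational inner function on $\mathbb{D}^3$ of degree $(m,n,1)$, with $p(z)=p_1(z_1,z_2)+z_3p_2(z_1,z_2)$, $\tilde p(z)=z_3\tilde p_1(z_1,z_2)+\tilde p_2(z_1,z_2)$, and assume $\mathcal{Z}_{\tilde p}\cap\mathbb{T}^3$ contains no vertical line $\{(\zeta_1,\zeta_2)\}\times\mathbb{T}$. Assume $\phi$ has a singularity at $(1,1,1)$, i.e. $(1,1,1)\in\mathcal{Z}_p$. Let $\rho(\theta_1,\theta_2)=1-|\psi^0(e^{i\theta_1},e^{i\theta_2})|^2$ with $\psi^0=-\tilde p_2/\tilde p_1$, and let $c_{2,0},c_{1,1},c_{0,2}$ be the coefficients of $\theta_1^2,\theta_1\theta_2,\theta_2^2$ in the Taylor expansion of $\rho$ at $(0,0)$ (so $c_{2,0}c_{0,2}\ge0$). Then: (a) if $c_{1,1}\ne\pm2\sqrt{c_{0,2}c_{2,0}}$, there is a neighborhood $V\subseteq\mathbb{T}^2$ of $(1,1)$ such that $\frac{\partial\phi}{\partial z_3}\in L^{\mathfrak{p}}(V\times\mathbb{T})$ if and only if $\mathfrak{p}<2$; (b) if $c_{1,1}=\pm2\sqrt{c_{0,2}c_{2,0}}$, there are a neighborhood $V\subseteq\mathbb{T}^2$ of $(1,1)$ and some $\mathfrak{p}<2$ such that $\frac{\partial\phi}{\partial z_3}\notin L^{\mathfrak{p}}(V\times\mathbb{T})$.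
   Context: A rational inner function (RIF) on $\mathbb{D}^3$ is a rational function holomorphic on the tridisk with unimodular radial limits a.e. on $\mathbb{T}^3$; it is written $\phi=\tilde p/p$ with $p$ zero-free on $\mathbb{D}^3$, $p,\tilde p$ without common factors. For degree $(m,n,1)$, $\tilde p(z)=z_1^mz_2^nz_3\overline{p(1/\bar z_1,1/\bar z_2,1/\bar z_3)}$ and $\tilde p_j(z_1,z_2)=z_1^mz_2^n\overline{p_j(1/\bar z_1,1/\bar z_2)}$. Under the no-vertical-line assumption $\tilde p_1$ has no zeros on $\mathbb{T}^2$, so $\rho$ is real analytic. $L^{\mathfrak{p}}$ is with respect to Lebesgue (arc-length) measure and $1\le \mathfrak{p}<\infty$. *)

(* Defs.v *)
From HB Require Import structures.
From mathcomp Require Import all_boot all_order all_algebra.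
From mathcomp Require Import all_classical all_reals all_analysis.
From mathcomp Require Import complex.
Set Implicit Arguments.
Unset Strict Implicit.
Unset Printing Implicit Defensive.
Import Order.TTheory GRing.Theory Num.Theory.
Import numFieldNormedType.Exports.
Local Open Scope ring_scope.
Local Open Scope classical_set_scope.

Section RIF.
Variable R : realType.
Local Notation C := (R[i]).

(* Bivariate polynomials in C[z1,z2] are {poly {poly C}}: the outer
   variable is z2, the inner one z1.  Trivariate polynomials are
   {poly {poly {poly C}}}: outer variable z3, then z2, innermost z1. *)

Definition eval2 (q : {poly {poly C}}) (z1 z2 : C) : C :=
  (map_poly (fun a : {poly C} => a.[z1]) q).[z2].

Definition eval3 (P : {poly {poly {poly C}}}) (z1 z2 z3 : C) : C :=
  (map_poly (fun q : {poly {poly C}} => eval2 q z1 z2) P).[z3].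

Definition bideg_le (m n : nat) (q : {poly {poly C}}) : Prop :=
  (size q <= n.+1)%N /\ forall j : nat, (size (q`_j)%R <= m.+1)%N.

(** reflection  q~(z1,z2) = z1^m z2^n conj(q(1/conj z1, 1/conj z2)),
    written on coefficients: the coefficient of z1^i z2^j of q~ is the
    conjugate of the coefficient of z1^(m-i) z2^(n-j) of q. *)
Definition refl2 (m n : nat) (q : {poly {poly C}}) : {poly {poly C}} :=
  \poly_(j < n.+1) \poly_(i < m.+1) conjc ((q`_(n - j)%N)`_(m - i)%N).

Definition pol3 (p1 p2 : {poly {poly C}}) : {poly {poly {poly C}}} :=
  p1%:P + 'X * p2%:P.

(** p~(z) = z1^m z2^n z3 conj(p(1/conj z)) = z3 p1~(z1,z2) + p2~(z1,z2) *)
Definition pol3_refl (m n : nat) (p1 p2 : {poly {poly C}}) :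
  {poly {poly {poly C}}} :=
  'X * (refl2 m n p1)%:P + (refl2 m n p2)%:P.

Definition phi (m n : nat) (p1 p2 : {poly {poly C}}) (z1 z2 z3 : C) : C :=
  eval3 (pol3_refl m n p1 p2) z1 z2 z3 / eval3 (pol3 p1 p2) z1 z2 z3.

(** d phi / d z3 for the rational function phi = p~/p (quotient rule, the
    z3-derivative of a polynomial being the derivative in the outer
    variable); undefined points (p = 0) get the junk value x/0 = 0. *)
Definition dphi_dz3 (m n : nat) (p1 p2 : {poly {poly C}}) (z1 z2 z3 : C) : C :=
  let P := pol3 p1 p2 in let Pt := pol3_refl m n p1 p2 in
  (eval3 Pt^`() z1 z2 z3 * eval3 P z1 z2 z3
     - eval3 Pt z1 z2 z3 * eval3 P^`() z1 z2 z3) / (eval3 P z1 z2 z3) ^+ 2.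

Definition cabs (z : C) : R := ComplexField.Normc.normc z.

Definition expi (t : R) : C := Complex (cos t) (sin t).

Definition onT (z : C) : Prop := cabs z = 1.

Definition psi0 (m n : nat) (p1 p2 : {poly {poly C}}) (z1 z2 : C) : C :=
  - (eval2 (refl2 m n p2) z1 z2 / eval2 (refl2 m n p1) z1 z2).

Definition rho (m n : nat) (p1 p2 : {poly {poly C}}) (t : R * R) : R :=
  1 - (cabs (psi0 m n p1 p2 (expi t.1) (expi t.2))) ^+ 2.

Definition c20 (f : R * R -> R) : R :=
  derive (fun a => derive f a (1, 0)) (0, 0) (1, 0) / 2.
Definition c11 (f : R * R -> R) : R :=
  derive (fun a => derive f a (0, 1)) (0, 0) (1, 0).
Definition c02 (f : R * R -> R) : R :=
  derive (fun a => derive f a (0, 1)) (0, 0) (0, 1) / 2.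

(** arc-length measure on T^3 in angle coordinates = Lebesgue on R^3 *)
Definition leb3 :=
  (((@lebesgue_measure R) \x (@lebesgue_measure R)) \x (@lebesgue_measure R))%E.

(** an open neighbourhood V of (1,1) in T^2, described in the angle chart
    (-pi,pi)^2 around (0,0) *)
Definition angle_nbhd (V : set (R * R)) : Prop :=
  open V /\ V (0, 0) /\
  V `<=` [set t | -pi < t.1 < pi /\ -pi < t.2 < pi].

Definition in_Lp_VxT (f : C -> C -> C -> C) (V : set (R * R)) (q : R) : Prop :=
  leb3.-integrable [set x | V (x.1.1, x.1.2) /\ -pi < x.2 < pi]
    (fun x => ((cabs (f (expi x.1.1) (expi x.1.2) (expi x.2))) `^ q)%:E).

End RIF.

(* Main.v *)
(* On the torus write p = p1 (1 + z3 w) with w = p2/p1 and rho = 1 - |w|^2, so that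
   |d phi/d z3| = rho / |1 + z3 w|^2 is a Poisson kernel in z3.  Its q-th power
   integrates over z3 to rho^(1-q), up to constants: from above by its supremum
   4/rho and its antiderivative th - 2 atan(Im/Re) of 1 + e^(i th) w, from below
   by an arc of length rho around its peak.

   Near (1,1), rho is comparable to the trigonometric polynomial
   D = |p1|^2 - |p2|^2 >= 0, which has a minimum at the origin.  If its Hessian is
   definite, D is comparable to x^2 + y^2; as x^2 + y^2 >= |x y|, the function
   rho^(1-q) is dominated by a product of integrable powers for q < 2, while for
   q >= 2 the squares of side r carry a mass bounded below.  If the Hessian
   degenerates along v, then D(t v + u w) <= C (t^4 + u^2), because the cubic term
   along v vanishes too, and the parallelograms r x r^2 carry a mass bounded below
   for q = 7/4.

   The zeros of D have to be negligible: the derivative vanishes there.  They are,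
   unless p1~ p1 = p2~ p2 identically; in that case p~ is a multiple of p,
   contradicting coprimality. *)
Require Import Defs.
From HB Require Import structures.
From mathcomp Require Import all_boot all_order all_algebra.
From mathcomp Require Import all_classical all_reals all_analysis.
From mathcomp Require Import complex.
Import Order.TTheory GRing.Theory Num.Theory.
Import numFieldNormedType.Exports.
Local Open Scope ring_scope.
Local Open Scope classical_set_scope.
From mathcomp Require Import measurable_realfun ring lra.
Set Implicit Arguments.
Unset Strict Implicit.
Unset Printing Implicit Defensive.

(** * Trigonometric polynomials *)

(** The quotient rule for p~/p has numerator p1~ p1 - p2~ p2, free of z3; on the torus it is a
    unimodular factor times D. A zero of p1 on the torus would also be a zero of p2, because |p2| <=
    |p1| there, and would produce a vertical line; so |p1| > 0 and rho = D / |p1|^2 is a smooth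
    quotient. The singularity says w = -1 at (1,1): hence D vanishes there, and Re w < 0 nearby
    keeps the peak of the kernel in z3 away from the ends of the angle chart.

    The exponents come from scaling. On squares of side r, the power rho^(1-q) is at least of order
    r^(-2(q-1)) against an area r^2, critical at q = 2. On the r x r^2 parallelograms it is
    r^(-4(q-1)) against r^3, critical at 4(q-1) = 3, that is q = 7/4. Mass bounded below on sets
    shrinking to a point contradicts integrability by dominated convergence, so the critical
    exponents call for no computation of a divergent integral.

    Real and imaginary parts on the torus are syntax trees, closed under partial derivatives and
    bounded by induction, so Taylor remainders have global constants. *)

Section PolynomialEvaluation.
Variable R : realType.

Lemma eval2_0 (z1 z2 : R[i]) : eval2 0 z1 z2 = 0.
Proof. by rewrite /eval2 (rmorph0 (map_poly (horner_eval z1))) horner0. Qed.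

Lemma eval2_MXaddC (p : {poly {poly R[i]}}) c z1 z2 :
  eval2 (p * 'X + c%:P) z1 z2 = eval2 p z1 z2 * z2 + c.[z1].
Proof.
rewrite /eval2 (rmorphD (map_poly (horner_eval z1))) /=.
by rewrite rmorphM /= map_polyX map_polyC hornerMXaddC.
Qed.

(** One induction for two substitutions: with [S] the trigonometric polynomials it parametrizes the
    torus, with [S] the real polynomials it follows a radius of the bidisk. *)
Lemma eval2_closed (T : Type) (S : (T -> R) -> Prop) :
  (forall c, S (fun=> c)) ->
  (forall f g, S f -> S g -> S (fun t => f t + g t)) ->
  (forall f g, S f -> S g -> S (fun t => f t * g t)) ->
  forall x1 y1 x2 y2, S x1 -> S y1 -> S x2 -> S y2 ->
  forall q : {poly {poly R[i]}}, exists f g, [/\ S f, S g & forall t,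
    eval2 q (Complex (x1 t) (y1 t)) (Complex (x2 t) (y2 t)) = Complex (f t) (g t)].
Proof.
move=> Sc Sa Sm.
have step x y f g u v : S x -> S y -> S f -> S g -> S u -> S v -> exists h k,
    [/\ S h, S k & forall t, Complex (f t) (g t) * Complex (x t) (y t)
      + Complex (u t) (v t) = Complex (h t) (k t)].
  move=> Sx Sy Sf Sg Su Sv.
  exists (fun t => f t * x t + -1 * (g t * y t) + u t),
    (fun t => f t * y t + g t * x t + v t); split.
  - by apply: (Sa) => //; apply: (Sa); [exact: Sm | apply: (Sm) => //; exact: Sm].
  - by apply: (Sa) => //; apply: (Sa); exact: Sm.
  - by move=> t; congr Complex => /=; ring.
move=> x1 y1 x2 y2 Sx1 Sy1 Sx2 Sy2.
have inner (c : {poly R[i]}) : exists f g, [/\ S f, S g & forall t,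
    c.[Complex (x1 t) (y1 t)] = Complex (f t) (g t)].
  elim/poly_ind: c => [|p [a b] [f [g [Sf Sg fg]]]].
    by exists (fun=> 0), (fun=> 0); split=> // t; rewrite horner0.
  have [h [k [Sh Sk hk]]] := step x1 y1 f g (fun=> a) (fun=> b) Sx1 Sy1 Sf Sg (Sc a) (Sc b).
  by exists h, k; split=> // t; rewrite hornerMXaddC fg hk.
elim/poly_ind => [|p c [f [g [Sf Sg fg]]]].
  by exists (fun=> 0), (fun=> 0); split=> // t; rewrite eval2_0.
have [u [v [Su Sv uv]]] := inner c.
have [h [k [Sh Sk hk]]] := step x2 y2 f g u v Sx2 Sy2 Sf Sg Su Sv.
by exists h, k; split=> // t; rewrite eval2_MXaddC fg uv hk.
Qed.

End PolynomialEvaluation.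

Section TrigonometricPolynomials.
Variable R : realType.

Inductive trig : Type :=
| TCst of R | TCos1 | TSin1 | TCos2 | TSin2
| TAdd of trig & trig | TMul of trig & trig.

Fixpoint teval (e : trig) (t : R * R) : R :=
  match e with
  | TCst c => c
  | TCos1 => cos t.1 | TSin1 => sin t.1
  | TCos2 => cos t.2 | TSin2 => sin t.2
  | TAdd f g => teval f t + teval g t
  | TMul f g => teval f t * teval g t
  end.

Fixpoint td1 (e : trig) : trig :=
  match e with
  | TCst _ => TCst 0
  | TCos1 => TMul (TCst (-1)) TSin1 | TSin1 => TCos1
  | TCos2 => TCst 0 | TSin2 => TCst 0
  | TAdd f g => TAdd (td1 f) (td1 g)
  | TMul f g => TAdd (TMul (td1 f) g) (TMul f (td1 g))
  end.

Fixpoint td2 (e : trig) : trig :=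
  match e with
  | TCst _ => TCst 0
  | TCos1 => TCst 0 | TSin1 => TCst 0
  | TCos2 => TMul (TCst (-1)) TSin2 | TSin2 => TCos2
  | TAdd f g => TAdd (td2 f) (td2 g)
  | TMul f g => TAdd (TMul (td2 f) g) (TMul f (td2 g))
  end.

Definition tdir (v : R * R) (e : trig) : trig :=
  TAdd (TMul (TCst v.1) (td1 e)) (TMul (TCst v.2) (td2 e)).

(** A derivative depends only on increments, so functions on different spaces with equal increments
    along two lines share it. This reduces directional derivatives in the plane to one variable. *)
Lemma is_derive_growth (V W : normedModType R) (f : V -> R) (g : W -> R)
    (a v : V) (b w : W) (df : R) :
  (forall h : R, f (h *: v + a) - f a = g (h *: w + b) - g b) ->
  is_derive b w g df -> is_derive a v f df.
Proof.
move=> fg [dg <-].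
have E : (fun h : R => h^-1 *: ((f \o shift a) (h *: v) - f a)) =
         (fun h : R => h^-1 *: ((g \o shift b) (h *: w) - g b)).
  by apply/funext => h /=; rewrite fg.
by split; [rewrite /derivable E | rewrite /derive E].
Qed.

Lemma is_derive_along (f : R * R -> R) (a v : R * R) (t df : R) :
  is_derive (t *: v + a) v f df -> is_derive t 1 (fun s : R => f (s *: v + a)) df.
Proof.
apply: is_derive_growth => h.
by rewrite -[h *: 1]/(h * 1) mulr1 scalerDl addrA.
Qed.

Lemma is_derive_affine (f : R -> R) (c d df : R) : is_derive d 1 f df ->
  is_derive (0 : R) 1 (fun h => f (h * c + d)) (c * df).
Proof.
move=> fd.
have Dg : is_derive (0 : R) 1 (fun h : R => h * c + d) c.
  apply: (@is_derive_growth _ _ _ id _ _ 0 c) => h.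
  by rewrite /GRing.scale /=; ring.
have -> : (fun h : R => f (h * c + d)) = f \o (fun h : R => h * c + d) by [].
rewrite mulrC; apply: is_derive1_comp; by rewrite mul0r add0r.
Qed.

Lemma is_derive_teval e a v : is_derive a v (teval e) (teval (tdir v e) a).
Proof.
elim: e => [c|||||f IHf g IHg|f IHf g IHg].
- apply: (@is_derive_eq _ _ _ _ _ _ _ 0); last by rewrite /=; ring.
  exact: (is_derive_cst c a v).
- apply: (@is_derive_eq _ _ _ _ _ _ _ (v.1 * - sin a.1)); last by rewrite /=; ring.
  apply: (@is_derive_growth _ _ _ (fun h : R => cos (h * v.1 + a.1)) _ _ 0 1).
    by move=> h /=; rewrite addr0 mul0r add0r /GRing.scale /= mulr1.
  exact: (@is_derive_affine cos).
- apply: (@is_derive_eq _ _ _ _ _ _ _ (v.1 * cos a.1)); last by rewrite /=; ring.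
  apply: (@is_derive_growth _ _ _ (fun h : R => sin (h * v.1 + a.1)) _ _ 0 1).
    by move=> h /=; rewrite addr0 mul0r add0r /GRing.scale /= mulr1.
  exact: (@is_derive_affine sin).
- apply: (@is_derive_eq _ _ _ _ _ _ _ (v.2 * - sin a.2)); last by rewrite /=; ring.
  apply: (@is_derive_growth _ _ _ (fun h : R => cos (h * v.2 + a.2)) _ _ 0 1).
    by move=> h /=; rewrite addr0 mul0r add0r /GRing.scale /= mulr1.
  exact: (@is_derive_affine cos).
- apply: (@is_derive_eq _ _ _ _ _ _ _ (v.2 * cos a.2)); last by rewrite /=; ring.
  apply: (@is_derive_growth _ _ _ (fun h : R => sin (h * v.2 + a.2)) _ _ 0 1).
    by move=> h /=; rewrite addr0 mul0r add0r /GRing.scale /= mulr1.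
  exact: (@is_derive_affine sin).
- apply: (is_derive_eq (is_deriveD IHf IHg)).
  by move=> /=; ring.
- apply: (is_derive_eq (is_deriveM IHf IHg)).
  by rewrite /GRing.scale /=; ring.
Qed.

Lemma teval_td2_td1 e t : teval (td2 (td1 e)) t = teval (td1 (td2 e)) t.
Proof. by elim: e => /= [|||||f -> g ->|f -> g ->] //; ring. Qed.

Lemma teval_bounded e : exists2 M, 0 <= M & forall t, `|teval e t| <= M.
Proof.
elim: e => [c|||||f [M M0 fM] g [N N0 gN]|f [M M0 fM] g [N N0 gN]] /=.
- by exists `|c|.
- by exists 1 => // t; rewrite ler_norml cos_geN1 cos_le1.
- by exists 1 => // t; rewrite ler_norml sin_geN1 sin_le1.
- by exists 1 => // t; rewrite ler_norml cos_geN1 cos_le1.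
- by exists 1 => // t; rewrite ler_norml sin_geN1 sin_le1.
- exists (M + N); first exact: addr_ge0.
  by move=> t; rewrite (le_trans (ler_normD _ _)) // lerD.
- exists (M * N); first exact: mulr_ge0.
  by move=> t; rewrite normrM ler_pM.
Qed.

Lemma eval2_teval (q : {poly {poly R[i]}}) : exists e f, forall t : R * R,
  eval2 q (expi t.1) (expi t.2) = Complex (teval e t) (teval f t).
Proof.
pose S (f : R * R -> R) := exists e, f = teval e.
have [|||||||f [g [[e ->] [e' ->] E]]] := @eval2_closed R _ S _ _ _
  (fun t => cos t.1) (fun t => sin t.1) (fun t => cos t.2) (fun t => sin t.2) _ _ _ _ q.
- by move=> c; exists (TCst c).
- by move=> _ _ [e ->] [e' ->]; exists (TAdd e e').
- by move=> _ _ [e ->] [e' ->]; exists (TMul e e').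
- by exists TCos1.
- by exists TSin1.
- by exists TCos2.
- by exists TSin2.
by exists e, e'.
Qed.

Lemma measurable_teval e : measurable_fun [set: R * R] (teval e).
Proof.
elim: e => [c|||||f IHf g IHg|f IHf g IHg] /=.
- exact: measurable_cst.
- exact: (measurableT_comp (continuous_measurable_fun (@continuous_cos R)) measurable_fst).
- exact: (measurableT_comp (continuous_measurable_fun (@continuous_sin R)) measurable_fst).
- exact: (measurableT_comp (continuous_measurable_fun (@continuous_cos R)) measurable_snd).
- exact: (measurableT_comp (continuous_measurable_fun (@continuous_sin R)) measurable_snd).
- exact: measurable_funD.
- exact: measurable_funM.
Qed.

(* Iterated mean value theorem; it spares the factorials of Taylor's formula. *)
Lemma derive_bound_pow (f df : R -> R) (C : R) k :
  (forall x : R, is_derive x (1 : R) f (df x)) -> f 0 = 0 ->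
  (forall x, `|df x| <= C * `|x| ^+ k) ->
  forall x, `|f x| <= C * `|x| ^+ k.+1.
Proof.
move=> fdf f0 dfC x.
have cf a b : {within `[a, b], continuous f}.
  by apply: derivable_within_continuous => y _; apply: ex_derive.
have C0 : 0 <= C by have := le_trans (normr_ge0 _) (dfC 1); rewrite normr1 expr1n mulr1.
have key y : `|y| <= `|x| -> `|df y * x| <= C * `|x| ^+ k.+1.
  move=> yx; rewrite normrM exprSr mulrA ler_wpM2r // (le_trans (dfC y)) //.
  by rewrite ler_wpM2l // lerXn2r ?nnegrE.
have [x0|x0|->] := ltgtP x 0; last by rewrite f0 normr0 mulr_ge0 ?exprn_ge0.
- have [c] := MVT x0 (fun y _ => fdf y) (cf _ _).
  rewrite in_itv /= f0 => /andP[xc c0] E.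
  have -> : f x = df c * x by lra.
  by apply: key; rewrite !ltr0_norm // lerN2 ltW.
- have [c] := MVT x0 (fun y _ => fdf y) (cf _ _).
  rewrite in_itv /= f0 => /andP[c0 xc] E.
  have -> : f x = df c * x by lra.
  by apply: key; rewrite !gtr0_norm // ltW.
Qed.

End TrigonometricPolynomials.

(** * Taylor bounds at a minimum *)

Section Taylor.
Variable R : realType.
Implicit Types (e : trig R) (v t : R * R).

Definition l1norm (v : R * R) : R := `|v.1| + `|v.2|.

Lemma l1norm_ge0 v : 0 <= l1norm v.
Proof. exact: addr_ge0. Qed.

Lemma taylor1_bound (f0 f1 : R -> R) (C : R) :
  (forall x : R, is_derive x (1 : R) f0 (f1 x)) -> (forall x, `|f1 x| <= C) ->
  forall x, `|f0 x - f0 0| <= C * `|x|.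
Proof.
move=> d0 b1 x.
apply: (@derive_bound_pow _ (fun y => f0 y - f0 0) f1 C 0) => [y||y].
- apply: (is_derive_eq (is_deriveB (d0 y) (is_derive_cst (f0 0) y 1))).
  by rewrite subr0.
- by rewrite subrr.
- by rewrite expr0 mulr1.
Qed.

Lemma taylor2_bound (f0 f1 f2 : R -> R) (C : R) :
  (forall x : R, is_derive x (1 : R) f0 (f1 x)) ->
  (forall x : R, is_derive x (1 : R) f1 (f2 x)) ->
  (forall x, `|f2 x| <= C) ->
  forall x, `|f0 x - f0 0 - x * f1 0| <= C * `|x| ^+ 2.
Proof.
move=> d0 d1 b2 x.
apply: (@derive_bound_pow _ (fun y => f0 y - f0 0 - y * f1 0)
          (fun y => f1 y - f1 0) C 1) => [y||y].
- apply: (is_derive_eq (is_deriveB (is_deriveB (d0 y) (is_derive_cst (f0 0) y 1))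
    (is_deriveM (is_derive_id y 1) (is_derive_cst (f1 0) y 1)))).
  by rewrite /GRing.scale /=; ring.
- by rewrite mul0r !subrr.
- by rewrite expr1; exact: (taylor1_bound d1 b2).
Qed.

Lemma taylor3_bound (f0 f1 f2 f3 : R -> R) (C : R) :
  (forall x : R, is_derive x (1 : R) f0 (f1 x)) ->
  (forall x : R, is_derive x (1 : R) f1 (f2 x)) ->
  (forall x : R, is_derive x (1 : R) f2 (f3 x)) ->
  (forall x, `|f3 x| <= C) ->
  forall x, `|f0 x - f0 0 - x * f1 0 - x * x / 2 * f2 0| <= C * `|x| ^+ 3.
Proof.
move=> d0 d1 d2 b3 x.
apply: (@derive_bound_pow _ (fun y => f0 y - f0 0 - y * f1 0 - y * y / 2 * f2 0)
          (fun y => f1 y - f1 0 - y * f2 0) C 2) => [y||y].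
- have q : is_derive y (1 : R) (fun y : R => y * y / 2 * f2 0) (y * f2 0).
    have -> : (fun y : R => y * y / 2 * f2 0) = (fun y => y * y * (f2 0 / 2)).
      by apply/funext => z; ring.
    apply: (is_derive_eq (is_deriveM (is_deriveM (is_derive_id y 1) (is_derive_id y 1))
       (is_derive_cst (f2 0 / 2) y 1))).
    by rewrite /GRing.scale /=; field.
  apply: (is_derive_eq (is_deriveB
    (is_deriveB (is_deriveB (d0 y) (is_derive_cst (f0 0) y 1))
    (is_deriveM (is_derive_id y 1) (is_derive_cst (f1 0) y 1))) q)).
  by rewrite /GRing.scale /=; ring.
- by rewrite !mul0r !subrr.
- exact: (taylor2_bound d1 d2 b3).
Qed.

Lemma is_derive_teval_along e v a (s : R) :
  is_derive s (1 : R) (fun s : R => teval e (s *: v + a))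
    (teval (tdir v e) (s *: v + a)).
Proof. exact/is_derive_along/is_derive_teval. Qed.

Lemma tdir_bound e : exists2 M, 0 <= M &
  forall v t, `|teval (tdir v e) t| <= M * l1norm v ^+ 1.
Proof.
have [M M0 eM] := teval_bounded (td1 e); have [N N0 eN] := teval_bounded (td2 e).
exists (M + N) => [|v t]; first exact: addr_ge0.
rewrite (le_trans (ler_normD _ _)) // !normrM.
have h1 := ler_wpM2l (normr_ge0 v.1) (eM t).
have h2 := ler_wpM2l (normr_ge0 v.2) (eN t).
have h3 := mulr_ge0 (normr_ge0 v.1) N0; have h4 := mulr_ge0 (normr_ge0 v.2) M0.
by rewrite /l1norm /=; nra.
Qed.

(** The coefficients of [tdir v] are constants, so one derivative can be moved onto [td1 e] and
    [td2 e], where the bound of the previous order applies; each step contributes one factor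
    [l1norm v]. *)
Lemma tdir2_bound e : exists2 M, 0 <= M &
  forall v t, `|teval (tdir v (tdir v e)) t| <= M * l1norm v ^+ 2.
Proof.
have [M M0 eM] := tdir_bound (td1 e); have [N N0 eN] := tdir_bound (td2 e).
exists (M + N) => [|v t]; first exact: addr_ge0.
have -> : teval (tdir v (tdir v e)) t =
    v.1 * teval (tdir v (td1 e)) t + v.2 * teval (tdir v (td2 e)) t by rewrite /=; ring.
rewrite (le_trans (ler_normD _ _)) // !normrM.
have h1 := ler_wpM2l (normr_ge0 v.1) (eM v t).
have h2 := ler_wpM2l (normr_ge0 v.2) (eN v t).
have L0 := exprn_ge0 1 (l1norm_ge0 v).
have h3 := mulr_ge0 (mulr_ge0 (normr_ge0 v.1) N0) L0.
have h4 := mulr_ge0 (mulr_ge0 (normr_ge0 v.2) M0) L0.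
have -> : l1norm v ^+ 2 = (`|v.1| + `|v.2|) * l1norm v ^+ 1 by rewrite exprS.
by move: (l1norm v ^+ 1) h1 h2 L0 h3 h4 => L; lra.
Qed.

Lemma tdir3_bound e : exists2 M, 0 <= M &
  forall v t, `|teval (tdir v (tdir v (tdir v e))) t| <= M * l1norm v ^+ 3.
Proof.
have [M M0 eM] := tdir2_bound (td1 e); have [N N0 eN] := tdir2_bound (td2 e).
exists (M + N) => [|v t]; first exact: addr_ge0.
have -> : teval (tdir v (tdir v (tdir v e))) t =
    v.1 * teval (tdir v (tdir v (td1 e))) t + v.2 * teval (tdir v (tdir v (td2 e))) t.
  by rewrite /=; ring.
rewrite (le_trans (ler_normD _ _)) // !normrM.
have h1 := ler_wpM2l (normr_ge0 v.1) (eM v t).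
have h2 := ler_wpM2l (normr_ge0 v.2) (eN v t).
have L0 := exprn_ge0 2 (l1norm_ge0 v).
have h3 := mulr_ge0 (mulr_ge0 (normr_ge0 v.1) N0) L0.
have h4 := mulr_ge0 (mulr_ge0 (normr_ge0 v.2) M0) L0.
have -> : l1norm v ^+ 3 = (`|v.1| + `|v.2|) * l1norm v ^+ 2 by rewrite exprS.
by move: (l1norm v ^+ 2) h1 h2 L0 h3 h4 => L; lra.
Qed.

Lemma teval_lipschitz0 e : exists2 M, 0 <= M &
  forall v, `|teval e v - teval e 0| <= M * l1norm v.
Proof.
have [M M0 eM] := tdir_bound e; exists M => // v.
have := taylor1_bound (is_derive_teval_along e v 0) (fun x => eM v _) 1.
by rewrite scale1r scale0r !addr0 normr1 mulr1.
Qed.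

Lemma teval_taylor2 e : exists2 M, 0 <= M & forall v,
  `|teval e v - teval e 0 - teval (tdir v e) 0| <= M * l1norm v ^+ 2.
Proof.
have [M M0 eM] := tdir2_bound e; exists M => // v.
have := taylor2_bound (is_derive_teval_along e v 0) (is_derive_teval_along _ v 0)
  (fun x => eM v _) 1.
by rewrite scale1r scale0r !addr0 normr1 expr1n !mulr1 !mul1r.
Qed.

Lemma teval_taylor3 e : exists2 M, 0 <= M & forall v,
  `|teval e v - teval e 0 - teval (tdir v e) 0 - teval (tdir v (tdir v e)) 0 / 2|
    <= M * l1norm v ^+ 3.
Proof.
have [M M0 eM] := tdir3_bound e; exists M => // v.
have := taylor3_bound (is_derive_teval_along e v 0) (is_derive_teval_along _ v 0)
  (is_derive_teval_along _ v 0) (fun x => eM v _) 1.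
by rewrite scale1r scale0r !addr0 normr1 !expr1n !mulr1 !mul1r [X in _ - X]mulrC.
Qed.

(** The limit as [s] decreases to 0, without limits: after division by the leading power of [s], a
    Taylor remainder is at most [M * s], and the leading coefficient inherits the sign. *)
Lemma ge0_of_ge0_linear (a M : R) : (forall s, 0 < s -> 0 <= a + M * s) -> 0 <= a.
Proof.
move=> H; rewrite leNgt; apply/negP => a0.
have M1 : 0 < `|M| + 1 by rewrite ltr_wpDl.
(* At this [s] the remainder [M * s] is at most [- a / 2], so the sum is still negative. *)
have s0 : 0 < - a / (`|M| + 1) / 2 by rewrite !divr_gt0 // oppr_gt0.
have := H _ s0; apply/negP; rewrite -ltNge.
have : M * (- a / (`|M| + 1) / 2) <= (`|M| + 1) * (- a / (`|M| + 1) / 2).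
  by rewrite ler_wpM2r ?(ltW s0) // (le_trans (ler_norm M)) ?lerDl.
have -> : (`|M| + 1) * (- a / (`|M| + 1) / 2) = - a / 2 by field; rewrite gt_eqF.
by lra.
Qed.

Lemma tevalZ e v s : teval (tdir (s *: v) e) 0 = s * teval (tdir v e) 0.
Proof. by rewrite /= /GRing.scale /=; ring. Qed.

Lemma teval2Z e v s : teval (tdir (s *: v) (tdir (s *: v) e)) 0 =
  s ^+ 2 * teval (tdir v (tdir v e)) 0.
Proof. by rewrite /= /GRing.scale /=; ring. Qed.

Lemma l1normZ v s : l1norm (s *: v) = `|s| * l1norm v.
Proof. by rewrite /l1norm /GRing.scale /= !normrM mulrDr. Qed.

Lemma tdir2_quad e v : teval (tdir v (tdir v e)) 0 =
  teval (td1 (td1 e)) 0 * v.1 ^+ 2 + 2 * teval (td1 (td2 e)) 0 * v.1 * v.2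
  + teval (td2 (td2 e)) 0 * v.2 ^+ 2.
Proof.
have := teval_td2_td1 e 0; rewrite /= => ->; ring.
Qed.

Section Minimum.
Variable e : trig R.
Hypotheses (e_ge0 : forall t, 0 <= teval e t) (e0 : teval e 0 = 0).

Let A := teval (td1 (td1 e)) 0.
Let B := teval (td1 (td2 e)) 0.
Let C := teval (td2 (td2 e)) 0.

Lemma min_grad v : teval (tdir v e) 0 = 0.
Proof.
have key w : 0 <= teval (tdir w e) 0.
  have [M M0 eM] := teval_taylor2 e.
  apply: (@ge0_of_ge0_linear _ (M * l1norm w ^+ 2)) => s s0.
  have := eM (s *: w); rewrite e0 subr0 tevalZ l1normZ (gtr0_norm s0); rewrite ler_norml => /andP[_].
  have := e_ge0 (s *: w); rewrite exprMn => h1 h2.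
  by rewrite -(pmulr_rge0 _ s0); lra.
apply/eqP; rewrite eq_le key andbT -oppr_ge0.
by have := key ((-1) *: v); rewrite tevalZ mulN1r.
Qed.

Lemma min_hess v : 0 <= teval (tdir v (tdir v e)) 0.
Proof.
suff : 0 <= teval (tdir v (tdir v e)) 0 / 2 by lra.
have [M M0 eM] := teval_taylor3 e.
apply: (@ge0_of_ge0_linear _ (M * l1norm v ^+ 3)) => s s0.
have := eM (s *: v); rewrite e0 min_grad !subr0 teval2Z l1normZ (gtr0_norm s0); rewrite ler_norml => /andP[_].
have := e_ge0 (s *: v); rewrite exprMn => h1 h2.
by rewrite -(pmulr_rge0 _ (exprn_gt0 2 s0)); lra.
Qed.

Lemma min_hess_disc : [/\ 0 <= A, 0 <= C & B ^+ 2 <= A * C].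
Proof.
have A0 : 0 <= A.
  by have := min_hess (1, 0); rewrite tdir2_quad /= -/A -/B -/C; lra.
have C0 : 0 <= C.
  by have := min_hess (0, 1); rewrite tdir2_quad /= -/A -/B -/C; lra.
(* On [(C, - B)] the Hessian form equals [C * (A * C - B ^+ 2)], which settles the case [C > 0]. *)
split => //; have h1 := min_hess (C, - B); have h2 := min_hess (- B, A).
have h3 := min_hess (1, - B).
rewrite !tdir2_quad /= -/A -/B -/C in h1 h2 h3.
have [C1|C1] := ltrP 0 C.
  by rewrite -subr_ge0 -(pmulr_rge0 _ C1); lra.
have C00 : C = 0 by lra.
rewrite C00 in h1 h2 h3 *.
suff -> : B = 0 by lra.
apply/eqP; rewrite -sqrf_eq0; apply/eqP.
(* With [C = 0] the form on this vector is [- B ^+ 2 * (A + 2)], so [B] must vanish. *)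
have h4 := min_hess (- B, A + 1); rewrite tdir2_quad /= -/A -/B -/C C00 in h4.
by nra.
Qed.

Lemma min_upper : exists2 M, 0 <= M & forall v, teval e v <= M * l1norm v ^+ 2.
Proof.
have [M M0 eM] := teval_taylor2 e; exists M => // v.
by have := eM v; rewrite e0 min_grad !subr0; rewrite ler_norml => /andP[_].
Qed.

Lemma min_lower : B ^+ 2 < A * C -> exists2 c, 0 < c & exists2 d, 0 < d &
  forall v, l1norm v < d -> c * l1norm v ^+ 2 <= teval e v.
Proof.
move=> disc; have [A0 C0 _] := min_hess_disc.
have AC : 0 < A + C by nra.
have [M M0 eM] := teval_taylor3 e.
(* Determinant over trace bounds the smaller eigenvalue from below. Half the quadratic form is then
   at least [l / 4 * l1norm v ^+ 2]; the radius below lets the cubic remainder take at most [l / 8]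
   of it. *)
pose l := (A * C - B ^+ 2) / (A + C).
have l0 : 0 < l by rewrite divr_gt0 // subr_gt0.
exists (l / 8); first lra.
have M1 : 0 < 8 * (M + 1) by lra.
exists (l / (8 * (M + 1))); first exact: divr_gt0.
move=> v; rewrite ltr_pdivlMr // => vd.
have := eM v; rewrite e0 min_grad !subr0 tdir2_quad -/A -/B -/C; rewrite ler_norml => /andP[h _].
have hq : l * (v.1 ^+ 2 + v.2 ^+ 2) <=
    A * v.1 ^+ 2 + 2 * B * v.1 * v.2 + C * v.2 ^+ 2.
  rewrite /l mulrAC ler_pdivrMr //.
  have := sqr_ge0 (A * v.1 + B * v.2); have := sqr_ge0 (B * v.1 + C * v.2).
  by nra.
have hn : l1norm v ^+ 2 <= 2 * (v.1 ^+ 2 + v.2 ^+ 2).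
  rewrite /l1norm -[v.1 ^+ 2]real_normK ?num_real // -[v.2 ^+ 2]real_normK ?num_real //.
  by have := sqr_ge0 (`|v.1| - `|v.2|); nra.
have n0 := l1norm_ge0 v.
have h3 : M * l1norm v ^+ 3 <= l / 8 * l1norm v ^+ 2.
  rewrite exprS mulrA; apply: ler_wpM2r; first exact: sqr_ge0.
  by nra.
have h4 : l * l1norm v ^+ 2 <= 2 * (l * (v.1 ^+ 2 + v.2 ^+ 2)).
  by have := ler_wpM2l (ltW l0) hn; lra.
by lra.
Qed.

Lemma line4_bound v : teval (tdir v (tdir v e)) 0 = 0 ->
  exists2 M, 0 <= M & forall s, teval e (s *: v) <= M * s ^+ 4.
Proof.
move=> v2.
pose f k s := teval (iter k (tdir v) e) (s *: v + 0).
have df k s : is_derive s (1 : R) (f k) (f k.+1 s) by exact: is_derive_teval_along.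
have f00 : f 0%N 0 = 0 by rewrite /f scale0r addr0 /= e0.
have f10 : f 1%N 0 = 0 by rewrite /f scale0r addr0 min_grad.
have f20 : f 2%N 0 = 0 by rewrite /f scale0r addr0.
have f0_ge0 s : 0 <= f 0%N s by exact: e_ge0.
have [M M0 fM] := teval_bounded (iter 4 (tdir v) e).
have f3M s : `|f 3%N s - f 3%N 0| <= M * `|s| := taylor1_bound (df 3%N) (fun x => fM _) s.
have [N N0 fN] := teval_bounded (iter 3 (tdir v) e).
have T s : `|f 0%N s - s * s * s * (f 3%N 0 / 6)| <= M * `|s| ^+ 4.
  apply: (@derive_bound_pow _ (fun y => f 0%N y - y * y * y * (f 3%N 0 / 6))
    (fun y => f 1%N y - y * y / 2 * f 3%N 0) M 3) => [y||y].
  - have I := is_derive_id y (1 : R).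
    apply: (is_derive_eq (is_deriveB (df 0%N y)
      (is_deriveM (is_deriveM (is_deriveM I I) I) (is_derive_cst (f 3%N 0 / 6) y 1)))).
    have Ef (g h : R -> R) z : (g * h) z = g z * h z by [].
    by rewrite /GRing.scale /= !Ef /=; field.
  - by rewrite f00 !mul0r subrr.
  - have := taylor3_bound (df 1%N) (df 2%N) (df 3%N) (fun x => fM _) y.
    by rewrite f10 f20 mulr0 !subr0.
(* The cubic term is odd in [s] and leads the expansion of a nonnegative function: the signs of [s]
   and [- s] together force it to vanish. *)
have g3 : f 3%N 0 = 0.
  apply/eqP; rewrite eq_le -oppr_ge0; apply/andP; split.
    apply: (@ge0_of_ge0_linear _ (6 * M)) => s s0.
    have := T (- s); rewrite ler_norml normrN (gtr0_norm s0) => /andP[_].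
    have := f0_ge0 (- s) => h1 h2.
    rewrite -(pmulr_rge0 _ (exprn_gt0 3 s0)); lra.
  apply: (@ge0_of_ge0_linear _ (6 * M)) => s s0.
  have := T s; rewrite ler_norml (gtr0_norm s0) => /andP[_].
  have := f0_ge0 s => h1 h2.
  rewrite -(pmulr_rge0 _ (exprn_gt0 3 s0)); lra.
exists M => // s.
have f3b x : `|f 3%N x| <= M * `|x| ^+ 1.
  by have := f3M x; rewrite g3 subr0 expr1.
have := derive_bound_pow (df 0%N) f00 (derive_bound_pow (df 1%N) f10
  (derive_bound_pow (df 2%N) f20 f3b)) s.
rewrite ler_norml => /andP[_]; rewrite /f addr0 /=.
by rewrite -[`|s| ^+ 4]/(`|s| ^+ (2 * 2)) exprM real_normK ?num_real // -exprM.
Qed.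

(* Uses D(a + u w) + D(a - u w) <= 2 D(a) + O(u^2) and D(a - u w) >= 0. *)
Lemma transverse_bound w : exists2 M, 0 <= M &
  forall a u, teval e (u *: w + a) <= 2 * teval e a + M * u ^+ 2.
Proof.
have [M M0 eM] := teval_bounded (tdir w (tdir w e)).
exists (2 * M) => [|a u]; first exact: mulr_ge0.
have T x : `|teval e (x *: w + a) - teval e a - x * teval (tdir w e) a| <= M * `|x| ^+ 2.
  have := taylor2_bound (is_derive_teval_along e w a)
    (is_derive_teval_along (tdir w e) w a) (fun x => eM _) x.
  by rewrite scale0r add0r.
have := T u; have := T (- u); rewrite normrN real_normK ?num_real // !ler_norml.
move=> /andP[_ h1] /andP[_ h2].
by have := e_ge0 (- u *: w + a); lra.
Qed.

(** The Hessian has the null vector [(1, - B / C)] when [C] is nonzero, and [(0, 1)] otherwise,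
    since then [B = 0] too. The first direction is a graph over the first axis and the second is
    vertical, hence two alternatives. [line4_bound] controls the null direction, [transverse_bound]
    the other. *)
Lemma degenerate_bound : B ^+ 2 = A * C -> exists M b : R, 0 <= M /\
  ((forall t u : R, teval e (t, b * t + u) <= M * (t ^+ 4 + u ^+ 2)) \/
   (forall t u : R, teval e (u, t) <= M * (t ^+ 4 + u ^+ 2))).
Proof.
move=> disc.
have pairE (s t a b c d : R) :
  s *: (a, b) + t *: (c, d) = (s * a + t * c, s * b + t * d) by [].
have combine v w : teval (tdir v (tdir v e)) 0 = 0 -> exists2 M, 0 <= M &
    forall t u : R, teval e (u *: w + t *: v) <= M * (t ^+ 4 + u ^+ 2).
  move=> /line4_bound[M M0 eM]; have [N N0 eN] := transverse_bound w.
  exists (2 * M + N) => [|t u]; first by rewrite addr_ge0 // mulr_ge0.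
  rewrite (le_trans (eN _ _)) //.
  have h1 := eM t; have h2 := mulr_ge0 N0 (exprn_even_ge0 t (isT : ~~ odd 4)).
  by have := mulr_ge0 M0 (sqr_ge0 u); lra.
have [C0|C0] := eqVneq C 0.
  have B0 : B = 0 by apply/eqP; rewrite -sqrf_eq0 disc C0 mulr0.
  have [|M M0 eM] := combine (0, 1) (1, 0).
    by rewrite tdir2_quad -/A -/B -/C C0 /=; ring.
  exists M, 0; split=> //; right => t u.
  have := eM t u; rewrite pairE; congr (teval e _ <= _).
  by congr pair; ring.
have [|M M0 eM] := combine (1, - B / C) (0, 1).
  rewrite tdir2_quad -/A -/B -/C /=.
  have -> : A * 1 ^+ 2 + 2 * B * 1 * (- B / C) + C * (- B / C) ^+ 2 = (A * C - B ^+ 2) / C.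
    by field.
  by rewrite disc subrr mul0r.
exists M, (- B / C); split=> //; left => t u.
have := eM t u; rewrite pairE; congr (teval e _ <= _).
by congr pair; ring.
Qed.

End Minimum.

End Taylor.

(** * Powers of the Poisson kernel *)

Section PoissonKernel.
Variable R : realType.
Local Notation mu := (@lebesgue_measure R).
Local Notation Ipi := (`](- pi)%R, (pi : R)[%classic).

(** The squared modulus of [1 + (a + i b) e^(i x)]. *)
Definition pden (a b x : R) : R :=
  (1 + (a * cos x - b * sin x)) ^+ 2 + (a * sin x + b * cos x) ^+ 2.

Lemma pdenE a b x : pden a b x = 1 + 2 * (a * cos x - b * sin x) + (a ^+ 2 + b ^+ 2).
Proof. by rewrite /pden; ring: (cos2sin2 x). Qed.

Lemma pden_ge0 a b x : 0 <= pden a b x.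
Proof. by rewrite addr_ge0 // sqr_ge0. Qed.

Lemma rot_sqr_le (a b x : R) : (a * cos x - b * sin x) ^+ 2 <= a ^+ 2 + b ^+ 2.
Proof.
have -> : a ^+ 2 + b ^+ 2 = (a * cos x - b * sin x) ^+ 2 + (a * sin x + b * cos x) ^+ 2.
  by ring: (cos2sin2 x).
by rewrite lerDl sqr_ge0.
Qed.

Lemma rot_bound (a b x : R) : - Num.sqrt (a ^+ 2 + b ^+ 2) <= a * cos x - b * sin x.
Proof.
have := rot_sqr_le a b x; rewrite -ler_sqrt ?sqr_ge0 ?addr_ge0 ?sqr_ge0 // sqrtr_sqr.
by rewrite ler_norml => /andP[].
Qed.

(** With [r] the modulus of [a + i b], the left factor is [1 - r ^+ 2 <= 2 * (1 - r)], and [1 - r]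
    is the distance from [1] to the circle of radius [r]. *)
Lemma pden_lower (a b x : R) : a ^+ 2 + b ^+ 2 <= 1 ->
  (1 - (a ^+ 2 + b ^+ 2)) ^+ 2 / 4 <= pden a b x.
Proof.
move=> ab; have := rot_bound a b x; rewrite pdenE.
have s0 : 0 <= a ^+ 2 + b ^+ 2 by rewrite addr_ge0 ?sqr_ge0.
have := sqr_sqrtr s0; set r := Num.sqrt _ => <-.
have r0 : 0 <= r by exact: sqrtr_ge0.
have r1 : r <= 1 by rewrite /r -sqrtr1 ler_sqrt.
move=> h.
have h2 : (1 - r ^+ 2) ^+ 2 <= 4 * (1 - r) ^+ 2.
  have -> : (1 - r ^+ 2) ^+ 2 = (1 + r) ^+ 2 * (1 - r) ^+ 2 by ring.
  apply: ler_wpM2r; first exact: sqr_ge0.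
  by nra.
by nra.
Qed.

Lemma continuous_rot (a b : R) : continuous (fun x => a * cos x - b * sin x).
Proof.
move=> x; apply: cvgB; apply: cvgM; try exact: cvg_cst.
  exact: continuous_cos.
exact: continuous_sin.
Qed.

Lemma continuous_pden (a b : R) : continuous (pden a b).
Proof.
have -> : pden a b = fun x => 1 + 2 * (a * cos x - b * sin x) + (a ^+ 2 + b ^+ 2).
  by apply/funext => x; exact: pdenE.
move=> x; apply: cvgD; last exact: cvg_cst.
apply: cvgD; first exact: cvg_cst.
apply: cvgM; first exact: cvg_cst.
exact: continuous_rot.
Qed.

Lemma poisson_integral_le (a b : R) : a ^+ 2 + b ^+ 2 < 1 ->
  (\int[mu]_(x in Ipi) ((1 - (a ^+ 2 + b ^+ 2)) / pden a b x)%:E <= (4 * pi)%:E)%E.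
Proof.
move=> ab.
pose f x := (1 - (a ^+ 2 + b ^+ 2)) / pden a b x.
have den0 x : 0 < pden a b x.
  apply: lt_le_trans (pden_lower _ (ltW ab)).
  by rewrite divr_gt0 // exprn_gt0 // subr_gt0.
have re0 x : 0 < 1 + (a * cos x - b * sin x).
  have := rot_bound a b x.
  have : Num.sqrt (a ^+ 2 + b ^+ 2) < 1 by rewrite -sqrtr1 ltr_sqrt.
  by lra.
(* This is [x - 2 arg(1 + w e^(i x))] with [w = a + i b]; its derivative is the real part of
   [(1 - w e^(i x)) / (1 + w e^(i x))]. By [re0] the real part of [1 + w e^(i x)] is positive, so
   [atan] gives the argument without a branch jump. *)
pose F x := x - 2 * atan ((a * sin x + b * cos x) / (1 + (a * cos x - b * sin x))).
have dF x : is_derive x (1 : R) F (f x).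
  have hx := cos2sin2 x; have rx := re0 x; have dx := den0 x.
  pose S y := a * sin y + b * cos y; pose C y := 1 + (a * cos y - b * sin y).
  have dS : is_derive x (1 : R) S (a * cos x - b * sin x).
    apply: (is_derive_eq (is_deriveD
      (is_deriveM (is_derive_cst a x 1) (is_derive_sin x))
      (is_deriveM (is_derive_cst b x 1) (is_derive_cos x)))).
    by rewrite /GRing.scale /=; ring.
  have dC : is_derive x (1 : R) C (- S x).
    apply: (is_derive_eq (is_deriveD (is_derive_cst (1 : R) x 1) (is_deriveB
      (is_deriveM (is_derive_cst a x 1) (is_derive_cos x))
      (is_deriveM (is_derive_cst b x 1) (is_derive_sin x))))).
    by rewrite /GRing.scale /= /S; ring.
  have dV : is_derive x (1 : R) (fun y => (C y)^-1) (- (C x) ^- 2 *: (- S x)).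
    split; first by apply: derivableV; rewrite ?gt_eqF.
    by rewrite deriveV ?gt_eqF // derive_val.
  have dA := @is_derive1_comp _ atan (fun y => S y / C y) x _ _
    (is_derive1_atan _) (is_deriveM dS dV).
  apply: (is_derive_eq (is_deriveB (is_derive_id x 1)
    (is_deriveM (is_derive_cst (2 : R) x 1) dA))).
  rewrite /f /GRing.scale /= pdenE.
  have Cx : C x != 0 by rewrite gt_eqF.
  have Px : 1 + 2 * (a * cos x - b * sin x) + (a ^+ 2 + b ^+ 2) != 0.
    by rewrite -pdenE gt_eqF.
  have S2 : S x ^+ 2 = 1 + 2 * (a * cos x - b * sin x) + (a ^+ 2 + b ^+ 2) - C x ^+ 2.
    by rewrite -pdenE /pden /C /S; ring.
  have -> : (1 + (S x / C x) ^+ 2)^-1 =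
      C x ^+ 2 / (1 + 2 * (a * cos x - b * sin x) + (a ^+ 2 + b ^+ 2)).
    by rewrite expr_div_n S2; field; rewrite Px Cx.
  have -> : S x * (- C x ^- 2 * - S x) = S x ^+ 2 / C x ^+ 2 by field.
  rewrite S2; move: Cx Px; rewrite /C; set X := a * cos x - b * sin x => Cx Px.
  by field; rewrite Px Cx.
have cf : continuous f.
  move=> x; apply: cvgM; first exact: cvg_cst.
  by apply: cvgV; [rewrite gt_eqF | exact: continuous_pden].
have pi0 : 0 < pi :> R by exact: pi_gt0.
have cF x : {for x, continuous F}.
  apply: differentiable_continuous; apply/derivable1_diffP; exact: ex_derive.
have mf : measurable_fun `[-pi, pi] (EFin \o f).
  apply/measurable_EFinP; apply: measurable_funTS.
  exact: (continuous_measurable_fun cf).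
apply: (@le_trans _ _ (\int[mu]_(x in `[(- pi)%R, (pi : R)]) (f x)%:E)%E).
  apply: ge0_subset_integral => //.
    by move=> x _; rewrite lee_fin divr_ge0 ?pden_ge0 // subr_ge0 ltW.
  exact: subset_itv_oo_cc.
rewrite (@continuous_FTC2 _ f F); first last.
- by move=> x _; rewrite derive1E; have /@derive_val := dF x.
- split; first by move=> x _; apply: ex_derive.
    by apply: cvg_at_right_filter; exact: cF.
  by apply: cvg_at_left_filter; exact: cF.
- exact: continuous_subspaceT.
- by lra.
rewrite -EFinB lee_fin /F.
(* The interval contributes [2 pi], and the two [atan] terms at most [pi] each. *)
set u := (X in _ - 2 * atan X - _); set v := (X in _ - (_ - 2 * atan X)).
have := atan_gtNpi2 u; have := atan_ltpi2 v; lra.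
Qed.

Lemma measurable_pden (a b : R) : measurable_fun setT (pden a b).
Proof. exact: (continuous_measurable_fun (@continuous_pden a b)). Qed.

Lemma measurable_funV_ge0 d (T : measurableType d) (D : set T) (f : T -> R) :
  (forall x, 0 <= f x) -> measurable_fun D f -> measurable_fun D (fun x => (f x)^-1).
Proof.
move=> f0 mf; have -> : (fun x => (f x)^-1) = (@powR R ^~ (-1)) \o f.
  by apply/funext => x /=; rewrite powR_inv1.
by apply: measurableT_comp => //; exact: measurable_powR.
Qed.

Lemma measurable_poisson_powR (a b c q : R) (D : set R) :
  measurable_fun D (fun x => (((c / pden a b x) `^ q)%:E)).
Proof.
apply/measurable_EFinP/measurable_funTS.
apply: (@measurableT_comp _ _ _ _ _ _ (@powR R ^~ q)); first exact: measurable_powR.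
apply: measurable_funM => //.
apply: measurable_funV_ge0; [exact: pden_ge0 | exact: measurable_pden].
Qed.

Lemma poisson_powR_le (a b q : R) : a ^+ 2 + b ^+ 2 < 1 -> 1 <= q ->
  (\int[mu]_(x in Ipi) (((1 - (a ^+ 2 + b ^+ 2)) / pden a b x) `^ q)%:E
   <= (4 * pi * (4 / (1 - (a ^+ 2 + b ^+ 2))) `^ (q - 1))%:E)%E.
Proof.
move=> ab q1; have := poisson_integral_le ab.
have dl x : (1 - (a ^+ 2 + b ^+ 2)) ^+ 2 / 4 <= pden a b x := pden_lower x (ltW ab).
set r := 1 - _ in dl *.
have r0 : 0 < r by rewrite subr_gt0.
set K := (4 / r) `^ (q - 1) => h.
have K0 : 0 <= K by exact: powR_ge0.
have mP := measurable_poisson_powR a b r 1.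
have P0 x : 0 <= r / pden a b x by rewrite divr_ge0 ?pden_ge0 // ltW.
apply: (@le_trans _ _ (\int[mu]_(x in Ipi) (K%:E * ((r / pden a b x) `^ 1)%:E))%E).
  apply: ge0_le_integral => //.
  - by move=> x _; rewrite lee_fin powR_ge0.
  - exact: measurable_poisson_powR.
  - by apply: emeasurable_funM; [exact: measurable_cst | exact: mP].
  - move=> x _; rewrite -EFinM lee_fin powRr1 // [K * _]mulrC -(@mulr_powRB1 _ (r / _) q) //; last lra.
    apply: ler_wpM2l => //; apply: ge0_ler_powR.
    + by rewrite subr_ge0.
    + by rewrite nnegrE.
    + by rewrite nnegrE divr_ge0 // ltW.
    have := dl x => dx.
    have d0 : 0 < pden a b x by apply: lt_le_trans dx; rewrite divr_gt0 // exprn_gt0.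
    rewrite ler_pdivrMr // mulrAC ler_pdivlMr //; lra.
rewrite (@ge0_integralZl _ _ _ mu Ipi _ _ (mP _) K%:E) //=; last first.
  by move=> x _; rewrite lee_fin powR_ge0.
rewrite [X in (_ <= X%:E)%E]mulrC EFinM; apply: lee_pmul => //.
- by rewrite integral_ge0 // => x _; rewrite lee_fin powR_ge0.
- by under eq_integral do rewrite powRr1 //.
Qed.

Lemma cos_sub1_bound (x : R) : `|cos x - 1| <= x ^+ 2.
Proof.
have := taylor2_bound (f0 := @cos R) (f1 := fun x => - sin x) (f2 := fun x => - cos x) (C := 1).
rewrite cos0 sin0; move=> H; have := H _ _ _ x; rewrite oppr0 mulr0 subr0 mul1r.
rewrite real_normK ?num_real //; apply => y.
  by rewrite normrN ler_norml cos_geN1 cos_le1.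
Qed.

(** The kernel peaks where [w e^(i x)] is a negative real, at [t0 = atan (b / - a)]. Since [a < 0]
    this lies within [pi / 2] of 0, so an arc of length [rh <= 1] starting at [t0] stays in the
    chart because [pi >= 2]. On it [pden] is at most [3 * rh ^+ 2]: one [rh ^+ 2] from
    [(1 - r) ^+ 2] and two from the cosine. *)
Lemma poisson_powR_ge (a b q : R) : a < 0 -> a ^+ 2 + b ^+ 2 < 1 -> 0 <= q ->
  (((1 - (a ^+ 2 + b ^+ 2)) * (3 * (1 - (a ^+ 2 + b ^+ 2)))^-1 `^ q)%:E <=
  \int[mu]_(x in Ipi) (((1 - (a ^+ 2 + b ^+ 2)) / pden a b x) `^ q)%:E)%E.
Proof.
move=> a0 ab q0.
pose s := a ^+ 2 + b ^+ 2; pose r := Num.sqrt s.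
have s0 : 0 < s by rewrite /s ltr_wpDr ?sqr_ge0 // exprn_even_gt0 //= lt_eqF.
have r0 : 0 < r by rewrite sqrtr_gt0.
have r2 : r ^+ 2 = s by rewrite sqr_sqrtr // ltW.
have r1 : r <= 1 by rewrite /r -sqrtr1 ler_sqrt // ltW.
have rn : r != 0 by rewrite gt_eqF.
have an : a != 0 by rewrite lt_eqF.
rewrite -/s; set rh := 1 - s.
have rh0 : 0 < rh by rewrite subr_gt0.
have rh1 : rh <= 1 by rewrite lerBlDr lerDl ltW.
pose t0 := atan (b / - a).
have ct : cos t0 = - a / r.
  rewrite cos_atan.
  have -> : 1 + (b / - a) ^+ 2 = (r / - a) ^+ 2.
    by rewrite [in RHS]expr_div_n r2 /s; field.
  rewrite sqrtr_sqr ger0_norm; last by rewrite divr_ge0 ?ltW // oppr_gt0.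
  by field; rewrite rn an.
have st : sin t0 = b / r.
  have c0 : cos t0 != 0 by rewrite ct mulf_neq0 ?oppr_eq0 ?invr_eq0.
  have : tan t0 = b / - a by exact: atanK.
  rewrite /tan => /(congr1 (fun x => x * cos t0)); rewrite mulfVK // => ->.
  by rewrite ct; field; rewrite rn an.
have tl : - (pi / 2) < t0 := atan_gtNpi2 _.
have tr : t0 < pi / 2 := atan_ltpi2 _.
have pi2 := pi_ge2 R.
have sub : `[t0, t0 + rh] `<=` Ipi.
  by move=> x /=; rewrite !in_itv /= => /andP[h1 h2]; apply/andP; split; lra.
have den x : x \in `[t0, t0 + rh]%R -> pden a b x <= 3 * rh ^+ 2.
  rewrite in_itv /= => /andP[h1 h2].
  have -> : pden a b x = (1 - r) ^+ 2 + 2 * r * (1 - cos (x - t0)).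
    rewrite pdenE cosB ct st -/s -r2; by field.
  have := cos_sub1_bound (x - t0); rewrite ler_norml => /andP[h3 _].
  have h4 : (x - t0) ^+ 2 <= rh ^+ 2 by nra.
  have h5 : (1 - r) ^+ 2 <= rh ^+ 2.
    have : 1 - r <= rh by rewrite /rh -r2; nra.
    by nra.
  have h6 : 0 <= 1 - cos (x - t0) by rewrite subr_ge0 cos_le1.
  have h7 : r * (1 - cos (x - t0)) <= 1 * rh ^+ 2.
    by apply: ler_pM => //; [exact: ltW | lra].
  by lra.
apply: (@le_trans _ _ (\int[mu]_(x in `[t0, (t0 + rh)%R]) (((3 * rh)^-1 `^ q)%:E))%E).
  rewrite integral_cst //= lebesgue_measure_itv /= lte_fin ltrDl rh0 -EFinD -EFinM lee_fin.
  by rewrite mulrC addrAC subrr add0r.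
apply: (@le_trans _ _ (\int[mu]_(x in `[t0, (t0 + rh)%R]) (((rh / pden a b x) `^ q)%:E))%E).
  apply: ge0_le_integral => //.
  - by move=> x _; rewrite lee_fin powR_ge0.
  - exact: measurable_poisson_powR.
  - move=> x xI; rewrite lee_fin; apply: ge0_ler_powR => //.
    + by rewrite nnegrE invr_ge0 mulr_ge0 // ltW.
    + by rewrite nnegrE divr_ge0 ?pden_ge0 // ltW.
    have := den x xI => dx.
    have d0 : 0 < pden a b x.
      apply: lt_le_trans (pden_lower _ (ltW ab)).
      by rewrite divr_gt0 // exprn_gt0.
    rewrite ler_pdivlMr // mulrC ler_pdivrMr ?mulr_gt0 //; lra.
apply: ge0_subset_integral => //.
- exact: measurable_poisson_powR.
- by move=> x _; rewrite lee_fin powR_ge0.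
Qed.
End PoissonKernel.

(** * Tonelli, shrinking sets, null sets *)

Section TonelliRectangle.
Context d1 d2 (T1 : measurableType d1) (T2 : measurableType d2) (R : realType).
Variables (m1 : {sigma_finite_measure set T1 -> \bar R})
          (m2 : {sigma_finite_measure set T2 -> \bar R}).
Variables (A : set T1) (B : set T2) (f : T1 * T2 -> \bar R).
Hypotheses (mA : measurable A) (mB : measurable B)
  (mf : measurable_fun setT f) (f0 : forall x, (0 <= f x)%E).

Lemma tonelli_rect :
  (\int[(m1 \x m2)%E]_(z in A `*` B) f z = \int[m1]_(x in A) \int[m2]_(y in B) f (x, y))%E.
Proof.
rewrite integral_mkcond fubini_tonelli1; first last.
- by move=> x; rewrite patchE; case: ifP.
- apply/(measurable_restrictT _ _).1; first exact: measurableX.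
  exact: measurable_funTS.
rewrite [RHS]integral_mkcond; apply: eq_integral => x _.
rewrite /fubini_F patchE; case: ifPn => xA.
  rewrite [RHS]integral_mkcond; apply: eq_integral => y _.
  by rewrite !patchE in_setX /= xA.
by apply: integral0_eq => y _; rewrite patchE in_setX /= (negbTE xA).
Qed.

Lemma measurable_inner_integral :
  measurable_fun A (fun x => \int[m2]_(y in B) f (x, y))%E.
Proof.
apply: measurable_funTS.
have -> : (fun x => \int[m2]_(y in B) f (x, y))%E = fubini_F m2 (f \_ (setT `*` B)).
  apply/funext => x; rewrite /fubini_F [LHS]integral_mkcond; apply: eq_integral => y _.
  by rewrite !patchE in_setX /= in_setT.
apply: measurable_fun_fubini_tonelli_F.
  apply/(measurable_restrictT _ _).1; first exact: measurableX.
  exact: measurable_funTS.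
by move=> x; rewrite patchE; case: ifP.
Qed.
End TonelliRectangle.

Section Singularity.
Variable R : realType.
Local Notation mu := (@lebesgue_measure R).

Lemma integral_abs_powR_lty (h s : R) : 0 < h -> 0 <= s -> s < 1 ->
  (\int[mu]_(x in `](- h)%R, h[%classic) (`|x| `^ (- s))%:E < +oo)%E.
Proof.
move=> h0 s0 s1.
pose f (x : R) := (`|x| `^ (- s))%:E.
have f0 x : (0 <= f x)%E by rewrite lee_fin powR_ge0.
have mf D : measurable_fun D f.
  apply/measurable_EFinP/measurable_funTS.
  apply: (@measurableT_comp _ _ _ _ _ _ (@powR R ^~ (- s))); first exact: measurable_powR.
  exact: normr_measurable.
have s10 : 0 < 1 - s by rewrite subr_gt0.
have sn : 1 - s != 0 by rewrite gt_eqF.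
pose c := h `^ (1 - s) / (1 - s).
(* With [n.+2] the left end is strictly below [h] already at [n = 0], as the fundamental theorem
   requires. *)
have bnd n : (\int[mu]_(x in `[(h / n.+2%:R)%R, h]%classic) f x <= c%:E)%E.
  set a := h / n.+2%:R.
  have a0 : 0 < a by rewrite divr_gt0.
  have ah : a < h by rewrite ltr_pdivrMr // ltr_pMr // ltr1n.
  pose F x := x `^ (1 - s) / (1 - s).
  have dF (x : R) : 0 < x -> is_derive x (1 : R) F (x `^ (- s)).
    move=> x0.
    apply: (is_derive_eq (is_deriveM (is_derive1_powR (1 - s) x0)
      (is_derive_cst (1 - s)^-1 x 1))).
    rewrite /GRing.scale /= mulr0 add0r.
    have -> : 1 - s - 1 = - s by ring.
    by rewrite mulrA mulVf // mul1r.
  have dG (x : R) : 0 < x -> is_derive x (1 : R) (@powR R ^~ (- s)) (- s * x `^ (- s - 1)).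
    by move=> x0; exact: is_derive1_powR.
  have cts (g : R -> R) (x d : R) : is_derive x (1 : R) g d ->
      {for x, continuous g}.
    by move=> [dgx _]; apply: differentiable_continuous; exact/derivable1_diffP.
  have -> : (\int[mu]_(x in `[a, h]%classic) f x =
      \int[mu]_(x in `[a, h]%classic) (x `^ (- s))%:E)%E.
    apply: eq_integral => x; rewrite inE /= in_itv /= => /andP[ax _].
    by rewrite /f gtr0_norm // (lt_le_trans a0).
  rewrite (@continuous_FTC2 _ (@powR R ^~ (- s)) F) //.
  - by rewrite -EFinB lee_fin /F /c lerBlDr lerDl divr_ge0 ?powR_ge0 // ltW.
  - apply: derivable_within_continuous => x; rewrite in_itv /= => /andP[ax _].
    by have [] := dG x (lt_le_trans a0 ax).
  - split.
    + by move=> x; rewrite in_itv /= => /andP[ax _]; have [] := dF x (lt_trans a0 ax).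
    + by apply: cvg_at_right_filter; exact: (cts _ _ _ (dF _ a0)).
    + by apply: cvg_at_left_filter; exact: (cts _ _ _ (dF _ h0)).
  - move=> x; rewrite in_itv /= => /andP[ax _].
    by rewrite derive1E; have /@derive_val := dF x (lt_trans a0 ax).
have pos : (\int[mu]_(x in `]0%R, h]%classic) f x <= c%:E)%E.
  have -> : `]0%R, h]%classic = \bigcup_n `[(h / n.+2%:R)%R, h]%classic.
    apply/seteqP; split=> x /=.
      rewrite in_itv /= => /andP[x0 xh].
      exists (Num.truncn (h / x)) => //=; rewrite in_itv /= xh andbT.
      rewrite ler_pdivrMr // mulrC -ler_pdivrMr // ltW // (lt_trans (truncnS_gt _)) //.
      by rewrite ltr_nat.
    move=> [n _] /=; rewrite !in_itv /= => /andP[h1 ->]; rewrite andbT.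
    by rewrite (lt_le_trans _ h1) // divr_gt0.
  have homo : {homo (fun n => `[(h / n.+2%:R)%R, h]%classic) :
      n k / (n <= k)%N >-> (n <= k)%O}.
    move=> n k nk; rewrite subsetEset => x /=; rewrite !in_itv /= => /andP[h1 ->].
    rewrite andbT (le_trans _ h1) // ler_pM2l // lef_pV2 ?posrE //.
    by rewrite ler_nat !ltnS.
  have cv : (\int[mu]_(x in `[(h / n.+2%:R)%R, h]%classic) f x)%E @[n --> \oo] -->
      (\int[mu]_(x in \bigcup_n `[(h / n.+2%:R)%R, h]%classic) f x)%E.
    by apply: ge0_nondecreasing_set_cvg_integral => // i; exact: mf.
  have /cvg_lim <- // := cv.
  apply: lime_le; first by apply/cvg_ex; eexists; exact: cv.
  by apply: nearW => n; exact: bnd.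
(* The function is restricted instead of the domain, so that the reflection [x -> - x] exchanges two
   half-lines. *)
have half : (\int[mu]_(x in `[0%R, +oo[%classic) (f \_ `](- h)%R, h[%classic) x <= c%:E)%E.
  rewrite -integral_mkcondr.
  have -> : `[0%R, +oo[%classic `&` `](- h)%R, h[%classic = `[0%R, h[%classic :> set R.
    apply/seteqP; split=> x /=; rewrite !in_itv /= andbT.
      by move=> [-> /andP[_ ->]].
    by move=> /andP[x0 ->]; rewrite x0 (lt_le_trans _ x0) // oppr_lt0.
  rewrite -integral_itv_obnd_cbnd //.
  apply: le_trans pos; apply: ge0_subset_integral => //; first exact: mf.
  by move=> x /=; rewrite !in_itv /= => /andP[-> /ltW ->].
pose g := f \_ `](- h)%R, h[%classic.
have g0 x : (0 <= g x)%E by rewrite /g patchE; case: ifP.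
have mg D : measurable_fun D g.
  by apply: measurable_funTS; exact/(measurable_restrictT _ _).1.
have gN x : g (- x) = g x.
  rewrite /g !patchE /f normrN; congr (if _ then _ else _).
  by apply/idP/idP; rewrite !inE /= !in_itv /=; lra.
have half' : (\int[mu]_(x in `]-oo, 0%R]%classic) g x <= c%:E)%E.
  apply: le_trans half; rewrite -/g ge0_integration_by_substitution0 //.
  by under [in X in (_ <= X)%E]eq_integral do rewrite gN.
rewrite integral_mkcond -/g.
have -> : setT = `]-oo, 0%R]%classic `|` `]0%R, +oo[%classic :> set R.
  apply/seteqP; split=> x //= _; rewrite !in_itv /= andbT.
  by case: (leP x 0); [left | right].
rewrite ge0_integral_setU //; last 2 first.
- exact: mg.
- rewrite disj_set2E; apply/eqP/seteqP; split=> x //=; rewrite !in_itv /= andbT => -[h1 h2].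
  by move: (lt_le_trans h2 h1); rewrite ltxx.
apply: (@le_lt_trans _ _ (c%:E + c%:E)%E); last by rewrite -EFinD ltry.
apply: leeD => //; apply: le_trans half; rewrite -/g; apply: ge0_subset_integral => //.
  exact: mg.
by move=> x /=; rewrite !in_itv /= !andbT => /ltW.
Qed.

End Singularity.

Section ShrinkingSets.
Context d (T : measurableType d) (R : realType).
Variable m : {measure set T -> \bar R}.

(** Dominated convergence with [g] itself as the majorant: outside [N] the restrictions of [g] to
    [S n] are eventually 0. *)
Lemma integral_shrinking_cvg0 (D N : set T) (S : nat -> set T) (g : T -> \bar R) :
  measurable D -> (forall n, measurable (S n)) -> (forall n, S n `<=` D) ->
  measurable N -> m N = 0%E ->
  (forall x, ~ N x -> \forall n \near \oo, ~ S n x) ->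
  (forall x, (0 <= g x)%E) -> m.-integrable D g ->
  (\int[m]_(x in S n) g x)%E @[n --> \oo] --> (0 : \bar R)%E.
Proof.
move=> mD mS SD mN N0 vanish g0 ig.
have mg : measurable_fun D g by case/integrableP: ig.
have mgS n : measurable_fun D (g \_ (S n)).
  have mgn : measurable_fun (S n) g by exact: measurable_funS (SD n) mg.
  by apply: measurable_funTS; exact/(measurable_restrictT _ _).1.
have Nn : m.-negligible N by exists N; split.
have [||||_ _] := @dominated_convergence _ _ R m D mD (fun n => g \_ (S n)) (cst 0%E) g mgS.
- exact: measurable_cst.
- apply: (negligibleS _ Nn) => x /= /not_implyP[Dx]; apply: contra_notP => nNx.
  have vx := vanish x nNx.
  apply: cvg_near_cst; apply: filterS vx => n nS; rewrite patchE ifN //.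
  by rewrite notin_setE.
- exact: ig.
- apply/aeW => x n Dx; rewrite patchE; case: ifP => _; first by rewrite gee0_abs.
  by rewrite abse0.
rewrite integral0_eq // => cv.
have -> : (fun n => \int[m]_(x in S n) g x)%E = (fun n => \int[m]_(x in D) (g \_ (S n)) x)%E.
  by apply/funext => n; rewrite -integral_mkcondr setIidr.
exact: cv.
Qed.

(** Integrability would make the integrals over [S n] tend to 0, while each is at least
    [L n * mS n >= k]. [N] holds the points to which the sets shrink, [Z] those where the pointwise
    bound may fail. *)
Lemma shrinking_not_integrable (D N Z : set T) (S : nat -> set T)
    (g : T -> \bar R) (L mS : nat -> R) (k : R) :
  measurable D -> (forall n, measurable (S n)) -> (forall n, S n `<=` D) ->
  measurable N -> m N = 0%E ->
  (forall x, ~ N x -> \forall n \near \oo, ~ S n x) ->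
  (forall x, (0 <= g x)%E) ->
  measurable Z -> m Z = 0%E -> 0 < k ->
  (forall n, m (S n) = (mS n)%:E) -> (forall n, k <= L n * mS n) ->
  (forall n, 0 <= L n) ->
  (forall n x, S n x -> ~ Z x -> ((L n)%:E <= g x)%E) ->
  ~ m.-integrable D g.
Proof.
move=> mD mS' SD mN N0 vanish g0 mZ Z0 k0 mSE kL L0 Lg ig.
have mg : measurable_fun D g by case/integrableP: ig.
have lower n : (k%:E <= \int[m]_(x in S n) g x)%E.
  have mgn : measurable_fun (S n) g by exact: measurable_funS (SD n) mg.
  apply: (@le_trans _ _ (\int[m]_(x in S n) (L n)%:E)%E).
    by rewrite integral_cst // mSE -EFinM lee_fin.
  rewrite (@ge0_negligible_integral _ _ _ m (S n) Z) //; last by move=> x _; rewrite lee_fin.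
  rewrite [X in (_ <= X)%E](@ge0_negligible_integral _ _ _ m (S n) Z) //.
  apply: ge0_le_integral => //.
  - exact: measurableD.
  - by move=> x _; rewrite lee_fin.
  - by apply: measurable_funS mgn => //; exact: subDsetl.
  - by move=> x [Sx nZ]; exact: Lg.
have cv := integral_shrinking_cvg0 mD mS' SD mN N0 vanish g0 ig.
have : (k%:E <= 0)%E.
  rewrite -(cvg_lim _ cv) //; apply: lime_ge; first by apply/cvg_ex; eexists; exact: cv.
  exact: nearW.
by rewrite lee_fin leNgt k0.
Qed.
End ShrinkingSets.

Section PlaneMeasure.
Variable R : realType.
Local Notation mu := (@lebesgue_measure R).
Local Notation mu2 := (mu \x mu)%E.

(** A rectangle sheared along the line of slope [b], the degenerate direction of the Hessian;
    shearing leaves the area [4 * r1 * r2] unchanged. *)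
Definition parallelogram (b r1 r2 : R) : set (R * R) :=
  [set t | `|t.1| < r1 /\ `|t.2 - b * t.1| < r2].

Lemma measurable_parallelogram b r1 r2 : measurable (parallelogram b r1 r2).
Proof.
have m1 : measurable_fun [set: R * R] (fun t : R * R => `|t.1|).
  by apply: measurableT_comp => //; exact: normr_measurable.
have m2 : measurable_fun [set: R * R] (fun t : R * R => `|t.2 - b * t.1|).
  apply: (@measurableT_comp _ _ _ _ _ _ (@Num.norm R R)); first exact: normr_measurable.
  apply: measurable_funB; first exact: measurable_snd.
  apply: measurable_funM; first exact: measurable_cst.
  exact: measurable_fst.
have -> : parallelogram b r1 r2 =
    (setT `&` (fun t : R * R => `|t.1|) @^-1` `]-oo, r1[) `&`
    (setT `&` (fun t : R * R => `|t.2 - b * t.1|) @^-1` `]-oo, r2[).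
  apply/seteqP; split=> t /=; rewrite !in_itv /=; first by move=> [? ?].
  by move=> [[_ ?] [_ ?]].
by apply: measurableI; [apply: m1 | apply: m2].
Qed.

Lemma measure_parallelogram b r1 r2 : 0 < r1 -> 0 < r2 ->
  mu2 (parallelogram b r1 r2) = (4 * r1 * r2)%:E.
Proof.
move=> r10 r20; rewrite /product_measure1 /=.
have E x : mu (xsection (parallelogram b r1 r2) x) =
    ((cst (2 * r2)%:E) \_ (`](- r1)%R, r1[%classic)) x.
  rewrite patchE; case: ifPn; rewrite ?notin_setE ?inE /= in_itv /= => xr.
    have -> : xsection (parallelogram b r1 r2) x = `](b * x - r2)%R, (b * x + r2)[%classic.
      apply/seteqP; split=> y; rewrite /xsection /parallelogram /= inE /= in_itv /=.
        by move=> [_]; rewrite ltr_norml => /andP[h1 h2]; apply/andP; split; lra.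
      move=> /andP[h1 h2]; split; first by rewrite ltr_norml.
      by rewrite ltr_norml; apply/andP; split; lra.
    rewrite lebesgue_measure_itv /= lte_fin ifT; last lra.
    by rewrite -EFinB /cst; congr EFin; ring.
  have -> : xsection (parallelogram b r1 r2) x = set0.
    apply/seteqP; split=> y //; rewrite /xsection /parallelogram /= inE /= ltr_norml => -[h _].
    by case: xr.
  by rewrite measure0.
under eq_integral do rewrite E.
rewrite -integral_mkcond integral_cst //= lebesgue_measure_itv /= lte_fin ifT; last lra.
by rewrite -EFinB -EFinM; congr EFin; ring.
Qed.

Lemma null_of_finite_sections (Z : set (R * R)) (X : set R) : measurable Z ->
  finite_set X -> (forall x, ~ X x -> finite_set (xsection Z x)) -> mu2 Z = 0%E.
Proof.
move=> mZ fX fZ; rewrite /product_measure1 /=.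
have mX : measurable X by exact: countable_measurable (finite_set_countable fX).
have X0 : mu X = 0%E by apply: countable_lebesgue_measure0; exact: finite_set_countable.
rewrite (@ge0_negligible_integral _ _ _ mu setT X) //.
- apply: integral0_eq => x [_ nX].
  by apply: countable_lebesgue_measure0; apply: finite_set_countable; exact: fZ.
- exact: measurable_fun_xsection.
Qed.

End PlaneMeasure.

(* In the library the sub-probability instance of product measures shadows the
   sigma-finite one, which therefore has to be supplied by hand. *)
Definition product_sigma_finite d1 d2 (T1 : measurableType d1)
    (T2 : measurableType d2) (R : realType)
    (m1 : {sigma_finite_measure set T1 -> \bar R})
    (m2 : {sigma_finite_measure set T2 -> \bar R})
    (sf : sigma_finite setT (m1 \x m2)%E) :
    {sigma_finite_measure set (T1 * T2)%type -> \bar R} :=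
  HB.pack (product_measure1 m1 m2)
    (Measure_isSigmaFinite.Build _ _ _ (m1 \x m2)%E sf).

Section PlaneSigmaFinite.
Variable R : realType.
Local Notation mu := (@lebesgue_measure R).

Lemma plane_sigma_finite : sigma_finite setT (mu \x mu)%E.
Proof.
pose A n : set R := `](- n%:R)%R, n%:R[%classic.
exists (fun n => A n `*` A n) => [|n].
  apply/seteqP; split=> // -[x y] _; exists (Num.truncn (`|x| + `|y|)).+1 => //.
  have := truncnS_gt (`|x| + `|y|); set k := _%:R => h.
  have := normr_ge0 x; have := normr_ge0 y => y0 x0.
  by split; rewrite /A /= in_itv /= -ltr_norml; lra.
have mA : measurable (A n) by exact: measurable_itv.
split; first exact: measurableX.
rewrite product_measure1E //= /A lebesgue_measure_itv /=.
by case: ifP => _; rewrite ?mule0 ?ltry // -!EFinD -EFinM ltry.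
Qed.

Definition plane_measure := product_sigma_finite plane_sigma_finite.

End PlaneSigmaFinite.

(** * Integrability of the kernel near a zero of D *)

Section KernelIntegrability.
Variable R : realType.
Local Notation mu := (@lebesgue_measure R).
Local Notation mu2 := (mu \x mu)%E.
Local Notation Ipi := (`](- pi)%R, (pi : R)[%classic).
Variables u1 v1 u2 v2 : trig R.

(** [u1 + i v1] and [u2 + i v2] stand for [p1] and [p2] on the torus. Then [defect] is |p1|^2 -
    |p2|^2, and [kden] below is the squared modulus of [p1 + z3 p2]. *)
Definition modsq (u v : trig R) : trig R := TAdd (TMul u u) (TMul v v).
Definition defect : trig R := TAdd (modsq u1 v1) (TMul (TCst (-1)) (modsq u2 v2)).

Local Notation D := (teval defect).
Local Notation N := (teval (modsq u1 v1)).

Definition kden (x : (R * R) * R) : R :=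
  (teval u1 x.1 + (teval u2 x.1 * cos x.2 - teval v2 x.1 * sin x.2)) ^+ 2 +
  (teval v1 x.1 + (teval u2 x.1 * sin x.2 + teval v2 x.1 * cos x.2)) ^+ 2.

Definition kern (q : R) (x : (R * R) * R) : \bar R := ((D x.1 / kden x) `^ q)%:E.

Hypotheses (D_ge0 : forall t, 0 <= D t) (N_gt0 : forall t, 0 < N t).

(** [wre + i wim] is the quotient [p2 / p1], with the denominator made real by the conjugate of
    [p1]. *)
Definition wre (t : R * R) : R :=
  (teval u1 t * teval u2 t + teval v1 t * teval v2 t) / N t.
Definition wim (t : R * R) : R :=
  (teval u1 t * teval v2 t - teval v1 t * teval u2 t) / N t.

Lemma defect_ratio t : D t / N t = 1 - (wre t ^+ 2 + wim t ^+ 2).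
Proof.
have := N_gt0 t; rewrite /wre /wim /= => n0.
by field; rewrite gt_eqF.
Qed.

Lemma kernE q t y : kern q (t, y) =
  (((1 - (wre t ^+ 2 + wim t ^+ 2)) / pden (wre t) (wim t) y) `^ q)%:E.
Proof.
rewrite -defect_ratio /kern /=; congr ((_ `^ _)%:E).
have n0 : N t != 0 by rewrite gt_eqF.
have -> : kden (t, y) = N t * pden (wre t) (wim t) y.
  rewrite pdenE /wre /wim /kden /=; rewrite /= in n0; field: (cos2sin2 y).
  exact: n0.
by rewrite invfM mulrA.
Qed.

Lemma kern_ge0 q x : (0 <= kern q x)%E.
Proof. by rewrite lee_fin powR_ge0. Qed.

Lemma measurable_kern q : measurable_fun setT (kern q).
Proof.
have mt e : measurable_fun [set: (R * R) * R] (fun x => teval e x.1).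
  exact: (measurableT_comp (measurable_teval e) measurable_fst).
have mc : measurable_fun [set: (R * R) * R] (fun x => cos x.2).
  exact: (measurableT_comp (continuous_measurable_fun (@continuous_cos R)) measurable_snd).
have ms : measurable_fun [set: (R * R) * R] (fun x => sin x.2).
  exact: (measurableT_comp (continuous_measurable_fun (@continuous_sin R)) measurable_snd).
apply/measurable_EFinP.
apply: (@measurableT_comp _ _ _ _ _ _ (@powR R ^~ q)); first exact: measurable_powR.
apply: measurable_funM; first exact: mt.
apply: measurable_funV_ge0; first by move=> x; rewrite addr_ge0 ?sqr_ge0.
apply: measurable_funD; apply: measurable_funX; apply: measurable_funD; try exact: mt.
  by apply: measurable_funB; apply: measurable_funM.
by apply: measurable_funD; apply: measurable_funM.
Qed.

Definition kint (q : R) (t : R * R) : \bar R := (\int[mu]_(y in Ipi) kern q (t, y))%E.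

Lemma kint_ge0 q t : (0 <= kint q t)%E.
Proof. by apply: integral_ge0 => y _; exact: kern_ge0. Qed.

Lemma measurable_kint q (A : set (R * R)) : measurable A -> measurable_fun A (kint q).
Proof.
move=> mA; apply: (@measurable_inner_integral _ _ _ _ R mu A Ipi (kern q)) => //.
- exact: measurable_kern.
- exact: kern_ge0.
Qed.

Lemma kern_integrable_iff q (V : set (R * R)) : measurable V ->
  (@leb3 R).-integrable (V `*` Ipi) (kern q) <-> mu2.-integrable V (kint q).
Proof.
move=> mV.
have E : (\int[@leb3 R]_(x in V `*` Ipi) kern q x = \int[mu2]_(t in V) kint q t)%E.
  apply: (@tonelli_rect _ _ _ _ R (plane_measure R) mu V Ipi (kern q)) => //.
  - exact: measurable_kern.
  - exact: kern_ge0.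
have mVI : measurable (V `*` Ipi) by exact: measurableX.
split=> /integrableP[mf fin]; apply/integrableP; split.
- exact: measurable_kint.
- under eq_integral do rewrite gee0_abs ?kint_ge0 //.
  by rewrite -E; under eq_integral do rewrite -[kern _ _]gee0_abs ?kern_ge0 //.
- by apply: measurable_funTS; exact: measurable_kern.
- under eq_integral do rewrite gee0_abs ?kern_ge0 //.
  by rewrite E; under eq_integral do rewrite -[kint _ _]gee0_abs ?kint_ge0 //.
Qed.

Lemma kint_le q t : 1 <= q -> 0 < D t ->
  (kint q t <= (4 * pi * (4 * N t / D t) `^ (q - 1))%:E)%E.
Proof.
move=> q1 Dt; have n0 := N_gt0 t.
have := @poisson_powR_le _ (wre t) (wim t) q; rewrite -subr_gt0 -defect_ratio.
rewrite divr_gt0 // => /(_ isT q1).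
have -> : 4 / (D t / N t) = 4 * N t / D t by field; rewrite !gt_eqF.
rewrite defect_ratio => /(le_trans _); apply.
by rewrite /kint; under eq_integral do rewrite kernE.
Qed.

(** One factor of the peak height [(3 * rho)^-1] cancels against the arc length [rho] and leaves
    [3^-1]. The remaining power decreases in [rho], so an upper bound [E] for [rho] may replace
    it. *)
Lemma kint_ge q t E : 1 <= q -> wre t < 0 -> 0 < D t -> D t / N t <= E ->
  ((3^-1 * (3 * E)^-1 `^ (q - 1))%:E <= kint q t)%E.
Proof.
move=> q1 w0 Dt rE; have n0 := N_gt0 t.
have := @poisson_powR_ge _ (wre t) (wim t) q w0; rewrite -subr_gt0 -defect_ratio.
have r0 : 0 < D t / N t by rewrite divr_gt0.
rewrite r0 => /(_ isT (le_trans ler01 q1)); rewrite defect_ratio.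
have -> : (\int[mu]_(x in Ipi) (((1 - (wre t ^+ 2 + wim t ^+ 2)) /
    pden (wre t) (wim t) x) `^ q)%:E = kint q t)%E.
  by rewrite /kint; under [RHS]eq_integral do rewrite kernE.
apply: le_trans; rewrite lee_fin -defect_ratio.
set r := D t / N t in rE r0 *.
have r30 : 0 <= (3 * r)^-1 by rewrite invr_ge0 mulr_ge0 // ltW.
rewrite -(@mulr_powRB1 _ _ q r30) ?(lt_le_trans ltr01) //.
rewrite mulrA; have -> : r * (3 * r)^-1 = 3^-1 by field; rewrite gt_eqF.
apply: ler_wpM2l; first by rewrite invr_ge0.
apply: ge0_ler_powR; rewrite ?nnegrE ?subr_ge0 //.
  by rewrite invr_ge0 mulr_ge0 // (le_trans (ltW r0)).
have E0 : 0 < E := lt_le_trans r0 rE.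
have h3 : 3 * r <= 3 * E by rewrite ler_wpM2l.
have p1 : 0 < 3 * r by lra.
have p2 : 0 < 3 * E by lra.
by rewrite lef_pV2 ?posrE.
Qed.

Definition square (h : R) : set (R * R) := `](- h)%R, h[%classic `*` `](- h)%R, h[%classic.

Lemma measurable_square h : measurable (square h).
Proof. by apply: measurableX; exact: measurable_itv. Qed.

(** The product majorant [|x|^(-s) |y|^(-s)] takes a conventional finite value on the axes, where it
    may fail to bound anything; they are discarded as a null set. *)
Lemma null_axes : measurable [set t : R * R | t.1 = 0 \/ t.2 = 0] /\
  mu2 [set t : R * R | t.1 = 0 \/ t.2 = 0] = 0%E.
Proof.
have mZ : measurable [set t : R * R | t.1 = 0 \/ t.2 = 0].
  have -> : [set t : R * R | t.1 = 0 \/ t.2 = 0] =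
      ([set 0] `*` setT) `|` (setT `*` [set 0]).
    apply/seteqP; split=> t /=; first by move=> [|] ?; [left|right].
    by move=> [[? _]|[_ ?]]; [left|right].
  by apply: measurableU; apply: measurableX => //; exact: measurable_set1.
split=> //; apply: (@null_of_finite_sections _ _ [set 0]) => // x x0.
apply: (@sub_finite_set _ _ [set 0]) => // y; rewrite /xsection /= inE /=.
by case.
Qed.

Lemma kern_integrable_of_lower (c h q : R) : 0 < c -> 0 < h -> 1 <= q -> q < 2 ->
  (forall t, square h t -> c * l1norm t ^+ 2 <= D t) ->
  (@leb3 R).-integrable (square h `*` Ipi) (kern q).
Proof.
move=> c0 h0 q1 q2 low.
apply/kern_integrable_iff; first exact: measurable_square.
apply/integrableP; split; first by apply: measurable_kint; exact: measurable_square.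
under eq_integral do rewrite gee0_abs ?kint_ge0 //.
have [M M0 NM] := teval_bounded (modsq u1 v1).
pose s := q - 1.
have s0 : 0 <= s by rewrite subr_ge0.
have s1 : s < 1 by rewrite /s; lra.
pose K := 4 * pi * (4 * (M + 1) / c) `^ s.
have K0 : 0 <= K by rewrite mulr_ge0 ?powR_ge0 // mulr_ge0 // pi_ge0.
pose J x := (`|x : R| `^ (- s))%:E.
have J0 x : (0 <= J x)%E by rewrite lee_fin powR_ge0.
have mJ : measurable_fun setT J.
  apply/measurable_EFinP.
  apply: (@measurableT_comp _ _ _ _ _ _ (@powR R ^~ (- s))); first exact: measurable_powR.
  exact: normr_measurable.
pose G (t : R * R) := (K%:E * (J t.1 * J t.2))%E.
have mG1 : measurable_fun [set: R * R] (fun t => J t.1 * J t.2)%E.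
  by apply: emeasurable_funM;
    [exact: (measurableT_comp mJ measurable_fst) | exact: (measurableT_comp mJ measurable_snd)].
have mG : measurable_fun [set: R * R] G.
  by apply: emeasurable_funM => //; exact: measurable_cst.
have G0 t : (0 <= G t)%E by rewrite mule_ge0 // mule_ge0.
have [mZ Z0] := null_axes.
set Z := [set t | _] in mZ Z0.
apply: (@le_lt_trans _ _ (\int[mu2]_(t in square h) G t)%E).
  rewrite (@ge0_negligible_integral _ _ _ (plane_measure R) (square h) Z) //; first last.
  - by move=> t _; exact: kint_ge0.
  - by apply: measurable_kint; exact: measurable_square.
  - exact: measurable_square.
  rewrite [X in (_ <= X)%E](@ge0_negligible_integral _ _ _ (plane_measure R) (square h) Z) //;
    first last.
  - exact: measurable_funTS.
  - exact: measurable_square.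
  have mSZ : measurable (square h `\` Z) by apply: measurableD => //; exact: measurable_square.
  apply: ge0_le_integral => //.
  - by move=> t _; exact: kint_ge0.
  - exact: measurable_kint.
  - exact: measurable_funTS.
  - move=> [x y] [Sxy /not_orP[/= x0 y0]].
    have ax : 0 < `|x| by rewrite normr_gt0; exact/eqP.
    have ay : 0 < `|y| by rewrite normr_gt0; exact/eqP.
    have lowt : c * (`|x| * `|y|) <= D (x, y).
      apply: le_trans (low _ Sxy); rewrite ler_pM2l // /l1norm /=.
      by have := mulr_gt0 ax ay; nra.
    have cxy : 0 < c * (`|x| * `|y|) by rewrite !mulr_gt0.
    have Dt : 0 < D (x, y) := lt_le_trans cxy lowt.
    apply: (le_trans (kint_le q1 Dt)); rewrite /G /J -!EFinM lee_fin /K -[leRHS]mulrA /=.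
    apply: ler_wpM2l; first by rewrite mulr_ge0 // pi_ge0.
    have Nt := N_gt0 (x, y); have := NM (x, y); rewrite gtr0_norm // => NMt.
    apply: (@le_trans _ _ ((4 * (M + 1) / c * (`|x|^-1 * `|y|^-1)) `^ s)).
      apply: ge0_ler_powR => //.
      + by rewrite nnegrE divr_ge0 ?mulr_ge0 // ltW.
      + by rewrite nnegrE mulr_ge0 ?divr_ge0 ?mulr_ge0 ?addr_ge0 ?invr_ge0 // ltW.
      have -> : 4 * (M + 1) / c * (`|x|^-1 * `|y|^-1) = 4 * (M + 1) / (c * (`|x| * `|y|)).
        by field; rewrite !gt_eqF.
      apply: ler_pM => //.
      + by rewrite mulr_ge0 // ltW.
      + by rewrite invr_ge0 ltW.
      + by rewrite ler_wpM2l // (le_trans NMt) // lerDl.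
      + by rewrite lef_pV2 ?posrE.
    have a1 : 0 <= 4 * (M + 1) / c.
      by rewrite divr_ge0 ?(ltW c0) // mulr_ge0 // addr_ge0.
    have inv_powR z : 0 < `|z| -> (`|z|^-1) `^ s = `|z| `^ (- s).
      by move=> _; rewrite -powR_inv1 // -powRrM mulN1r.
    have a2 : 0 <= `|x|^-1 * `|y|^-1 by rewrite mulr_ge0 ?invr_ge0.
    rewrite (powRM _ a1 a2).
    by rewrite [X in _ * X <= _]powRM ?invr_ge0 // !inv_powR.
have -> : (\int[mu2]_(t in square h) G t =
    K%:E * (\int[mu2]_(t in square h) (J t.1 * J t.2)))%E.
  apply: (@ge0_integralZl _ _ _ (plane_measure R)).
  - exact: measurable_square.
  - exact: measurable_funTS.
  - by move=> t _; rewrite mule_ge0.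
  - by rewrite lee_fin.
have -> : (\int[mu2]_(t in square h) (J t.1 * J t.2) =
    (\int[mu]_(x in `](- h)%R, h[%classic) \int[mu]_(y in `](- h)%R, h[%classic) (J x * J y)))%E.
  apply: (@tonelli_rect _ _ _ _ R mu mu _ _ (fun t => J t.1 * J t.2)%E) => //.
  by move=> t; rewrite mule_ge0.
have JI := integral_abs_powR_lty h0 s0 s1.
set I := (\int[mu]_(x in `](- h)%R, h[%classic) J x)%E.
have I0 : (0 <= I)%E by apply: integral_ge0 => x _.
have -> : (\int[mu]_(x in `](- h)%R, h[%classic) \int[mu]_(y in `](- h)%R, h[%classic) (J x * J y)
    = I * I)%E.
  rewrite -ge0_integralZr //; last by apply: measurable_funTS.
  apply: eq_integral => x _; rewrite ge0_integralZl //.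
  by apply: measurable_funTS.
have If : I \is a fin_num by rewrite ge0_fin_numE.
by rewrite -(fineK If) -!EFinM ltry.
Qed.

(** [Es n] bounds [rho] on the n-th parallelogram, so [k] is a lower bound for the value from
    [kint_ge] times the area. Zeros of D go into the exceptional set, since the kernel is 0
    there. *)
Lemma kern_not_integrable (h q b k : R) (Es r1 r2 : nat -> R) : 0 < h -> 1 <= q ->
  (forall t, square h t -> wre t < 0) ->
  mu2 (square h `&` [set t | D t = 0]) = 0%E ->
  (forall n, 0 < Es n) -> (forall n, 0 < r1 n) -> (forall n, 0 < r2 n) ->
  r1 @ \oo --> (0 : R) -> r2 @ \oo --> (0 : R) ->
  (forall n, parallelogram b (r1 n) (r2 n) `<=` square h) ->
  (forall n t, parallelogram b (r1 n) (r2 n) t -> D t / N t <= Es n) ->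
  0 < k -> (forall n, k <= 3^-1 * (3 * Es n)^-1 `^ (q - 1) * (4 * r1 n * r2 n)) ->
  ~ (@leb3 R).-integrable (square h `*` Ipi) (kern q).
Proof.
move=> h0 q1 w0 Z0 E0 r10 r20 r1c r2c sub DE k0 kE.
move=> /(kern_integrable_iff _ (measurable_square h)).
have mD : measurable [set t | D t = 0].
  rewrite -[X in measurable X]setTI.
  exact: (measurable_teval defect measurableT (measurable_set1 0)).
have mZ : measurable (square h `&` [set t | D t = 0]).
  by apply: measurableI => //; exact: measurable_square.
have [mA A0] := null_axes.
have m0 : measurable [set (0 : R * R)].
  have -> : [set (0 : R * R)] = [set 0] `*` [set 0].
    by apply/seteqP; split=> [t ->//|[x y] /= [-> ->]].
  by apply: measurableX; exact: measurable_set1.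
have N00 : mu2 [set (0 : R * R)] = 0%E.
  apply: (@null_of_finite_sections _ _ [set 0]) => // x x0.
  apply: (@sub_finite_set _ _ [set 0]) => // y; rewrite /xsection /= inE /=.
  by move=> [].
apply: (@shrinking_not_integrable _ _ R (plane_measure R) (square h) [set (0 : R * R)]
  (square h `&` [set t | D t = 0]) (fun n => parallelogram b (r1 n) (r2 n)) (kint q)
  (fun n => 3^-1 * (3 * Es n)^-1 `^ (q - 1)) (fun n => 4 * r1 n * r2 n) k) => //.
- exact: measurable_square.
- by move=> n; exact: measurable_parallelogram.
- move=> [x y] /= xy0.
  have [x0|x0] := eqVneq x 0.
    have y0 : 0 < `|y| by rewrite normr_gt0; apply/eqP => y0; apply: xy0; rewrite x0 y0.
    apply: (filterS _ (cvgr_lt 0 r2c _ y0)) => n rn [_ /=].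
    by rewrite x0 mulr0 subr0 => /lt_trans/(_ rn); rewrite ltxx.
  have xp : 0 < `|x| by rewrite normr_gt0.
  apply: (filterS _ (cvgr_lt 0 r1c _ xp)) => n rn [/= + _].
  by move=> /lt_trans/(_ rn); rewrite ltxx.
- by move=> t; exact: kint_ge0.
- by move=> n; exact: measure_parallelogram.
- by move=> n; rewrite mulr_ge0 ?invr_ge0 // powR_ge0.
- move=> n t St nZ; apply: kint_ge => //.
  + exact/w0/(sub n).
  + rewrite lt_neqAle D_ge0 andbT eq_sym; apply/eqP => Dt; apply: nZ; split=> //.
    exact: (sub n).
  + exact: DE St.
Qed.

End KernelIntegrability.

(** * The definite and the degenerate Hessian *)

Section LocalAnalysis.
Variable R : realType.
Local Notation mu := (@lebesgue_measure R).
Local Notation mu2 := (mu \x mu)%E.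
Local Notation Ipi := (`](- pi)%R, (pi : R)[%classic).
Variables u1 v1 u2 v2 : trig R.
Local Notation D := (teval (defect u1 v1 u2 v2)).
Local Notation N := (teval (modsq u1 v1)).
Hypotheses (D_ge0 : forall t, 0 <= D t) (N_gt0 : forall t, 0 < N t)
  (u0 : teval u2 0 = - teval u1 0) (v0 : teval v2 0 = - teval v1 0)
  (Z0 : mu2 (square pi `&` [set t | D t = 0]) = 0%E).

Let A := teval (td1 (td1 (defect u1 v1 u2 v2))) 0.
Let B := teval (td1 (td2 (defect u1 v1 u2 v2))) 0.
Let C := teval (td2 (td2 (defect u1 v1 u2 v2))) 0.

Lemma defect0 : D 0 = 0.
Proof. by rewrite /= u0 v0; ring. Qed.

(** At the origin [p2 = - p1], so the numerator of [wre] equals [- N 0]. The radius lets neither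
    this numerator nor [N] move by more than [N 0 / 2]; the summand [N 0] in the denominator of the
    witness gives [h <= 1]. *)
Lemma near_origin : exists h : R, [/\ 0 < h, h <= 1 & forall t, l1norm t < 2 * h ->
  wre u1 v1 u2 v2 t < 0 /\ N 0 / 2 <= N t].
Proof.
have [M M0 WM] := teval_lipschitz0 (TAdd (TMul u1 u2) (TMul v1 v2)).
have [K K0 NK] := teval_lipschitz0 (modsq u1 v1).
have n0 := N_gt0 0.
have d0 : 0 < 4 * (M + K + N 0 + 1) by lra.
exists (N 0 / (4 * (M + K + N 0 + 1))); split.
- exact: divr_gt0.
- by rewrite ler_pdivrMr // mul1r; lra.
move=> t; have l0 := l1norm_ge0 t.
have -> : 2 * (N 0 / (4 * (M + K + N 0 + 1))) = N 0 / 2 / (M + K + N 0 + 1).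
  by field; rewrite gt_eqF //; lra.
rewrite ltr_pdivlMr; last lra.
move=> h.
have h1 : M * l1norm t <= N 0 / 2.
  by have := mulr_ge0 K0 l0; have := mulr_ge0 (ltW n0) l0; lra.
have h2 : K * l1norm t <= N 0 / 2.
  by have := mulr_ge0 M0 l0; have := mulr_ge0 (ltW n0) l0; lra.
split; last by have := NK t; rewrite ler_norml => /andP[h3 _]; lra.
rewrite /wre pmulr_llt0 ?invr_gt0 //.
have W0 : teval (TAdd (TMul u1 u2) (TMul v1 v2)) 0 = - N 0 by rewrite /= u0 v0; ring.
by have := WM t; rewrite W0 ler_norml => /andP[_]; rewrite [teval (TAdd _ _) t]/=; lra.
Qed.

Lemma square_l1norm h (t : R * R) : square h t -> l1norm t < 2 * h.
Proof. by move=> []; rewrite /= !in_itv /= -!ltr_norml /l1norm => h1 h2; lra. Qed.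

Lemma square_null h : h <= pi -> mu2 (square h `&` [set t | D t = 0]) = 0%E.
Proof.
move=> hpi.
have mD : measurable [set t | D t = 0].
  rewrite -[X in measurable X]setTI.
  exact: (measurable_teval _ measurableT (measurable_set1 0)).
have mS k : measurable (square k `&` [set t | D t = 0]).
  by apply: measurableI => //; exact: measurable_square.
apply/eqP; rewrite eq_le; apply/andP; split; last exact: (measure_ge0 (plane_measure R)).
rewrite -[X in (_ <= X)%E]Z0; apply: (le_measure (plane_measure R)).
- by rewrite inE; exact: mS.
- by rewrite inE; exact: mS.
move=> t [[/= ]]; rewrite !in_itv /= => h1 h2 h3; split=> //; split; rewrite /= in_itv /=; lra.
Qed.

Lemma harmonic_scale_cvg (e : R) : (fun n : nat => e / n.+1%:R) @ \oo --> (0 : R).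
Proof.
rewrite -[X in _ --> X](mulr0 e); apply: cvgM; first exact: cvg_cst.
exact: cvg_harmonic.
Qed.

(** One square serves every [q]: [h] depends only on [near_origin] and on the radius of the
    quadratic lower bound. *)
Lemma definite_case : B ^+ 2 < A * C -> exists h, [/\ 0 < h, h <= 1 &
  forall q, 1 <= q ->
    ((@leb3 R).-integrable (square h `*` Ipi) (kern u1 v1 u2 v2 q) <-> q < 2)].
Proof.
move=> disc.
have [h0 [h00 h01 nearh]] := near_origin.
have [c c0 [d d0 low]] := min_lower D_ge0 defect0 disc.
have [M M0 up] := min_upper D_ge0 defect0.
have n0 := N_gt0 0.
pose h := Num.min h0 (d / 2).
have hpos : 0 < h by rewrite lt_min h00 divr_gt0.
have hh0 : h <= h0 by rewrite ge_min lexx.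
have hd : 2 * h <= d by rewrite mulrC -ler_pdivlMr // ge_min lexx orbT.
exists h; split=> //; first exact: le_trans hh0 h01.
move=> q q1; split; last first.
  move=> q2; apply: (kern_integrable_of_lower N_gt0 c0 hpos q1 q2).
  by move=> t /square_l1norm ht; apply: low; lra.
move=> ki; rewrite ltNge; apply/negP => q2; move: ki.
(* Makes [rho <= K * r ^+ 2] on the square with [|t.1|, |t.2| < r]: there [D <= M * (2 * r) ^+ 2],
   and [N >= N 0 / 2]. *)
pose K := 8 * M / N 0 + 1.
have K1 : 1 <= K by rewrite lerDr divr_ge0 ?mulr_ge0 // ltW.
have K0 : 0 < K by lra.
(* The second bound gives [3 * K * r ^+ 2 <= 1]. The base [(3 * K * r ^+ 2)^-1] is then at least 1,
   so for [q >= 2] its power [q - 1] is at least the base; times [3^-1] and the area [4 * r ^+ 2]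
   this is [4 / (9 * K)]. *)
pose e := Num.min h (3 * K)^-1.
have e0 : 0 < e by rewrite lt_min hpos invr_gt0 mulr_gt0.
have eh : e <= h by rewrite ge_min lexx.
have eK : 3 * K * e <= 1.
  by rewrite mulrC -ler_pdivlMr ?mulr_gt0 // mul1r ge_min lexx orbT.
pose r (n : nat) := e / n.+1%:R.
have r0 n : 0 < r n by rewrite divr_gt0.
have re n : r n <= e by rewrite ler_pdivrMr // ler_peMr ?(ltW e0) // ler1n.
have sub n : parallelogram 0 (r n) (r n) `<=` square h.
  move=> t [/= h1]; rewrite mul0r subr0 => h2.
  by split; rewrite /= in_itv /= -ltr_norml; have := re n; lra.
apply: (@kern_not_integrable _ u1 v1 u2 v2 D_ge0 N_gt0 h q 0 (4 / (9 * K))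
  (fun n => K * r n ^+ 2) r r) => //.
- move=> t /square_l1norm ht; have [] // := nearh t; lra.
- by apply: square_null; have := pi_ge2 R; lra.
- by move=> n; rewrite mulr_gt0 // exprn_gt0.
- exact: harmonic_scale_cvg.
- exact: harmonic_scale_cvg.
- move=> n t St.
  have /square_l1norm ht := sub n t St.
  have [|_ Nt] := nearh t; first lra.
  rewrite ler_pdivrMr //; apply: (le_trans (up t)).
  have lr : l1norm t ^+ 2 <= 4 * r n ^+ 2.
    case: St => h1; rewrite mul0r subr0 => h2; have := l1norm_ge0 t.
    have : l1norm t <= 2 * r n by rewrite /l1norm; lra.
    by have := r0 n; nra.
  apply: (@le_trans _ _ (M * (4 * r n ^+ 2))); first exact: ler_wpM2l.
  apply: (@le_trans _ _ (K * r n ^+ 2 * (N 0 / 2))); last first.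
    by apply: ler_wpM2l => //; rewrite mulr_ge0 ?sqr_ge0 // ltW.
  have -> : K * r n ^+ 2 * (N 0 / 2) = M * (4 * r n ^+ 2) + r n ^+ 2 * (N 0 / 2).
    by rewrite /K; field; rewrite gt_eqF.
  by rewrite lerDl mulr_ge0 ?sqr_ge0 // divr_ge0 // ltW.
- by rewrite divr_gt0 // mulr_gt0.
- move=> n; have rn := r0 n.
  have x0 : 0 < 3 * (K * r n ^+ 2) by rewrite !mulr_gt0 // exprn_gt0.
  have x1 : 3 * (K * r n ^+ 2) <= 1.
    have h1 : 3 * K * (r n * r n) <= 3 * K * (e * r n).
      by rewrite ler_wpM2l ?mulr_ge0 ?(ltW K0) // ler_wpM2r ?(ltW rn).
    have h2 : 3 * K * e * r n <= 1 * 1.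
      by apply: ler_pM; rewrite ?mulr_ge0 ?(ltW K0) ?(ltW e0) ?(ltW rn) //; have := re n; lra.
    by rewrite expr2; lra.
  have y1 : 1 <= (3 * (K * r n ^+ 2))^-1 by rewrite invr_ge1 // unitfE gt_eqF.
  have := @ler_powR _ _ y1 1 (q - 1); rewrite powRr1 ?(le_trans ler01 y1) // => /(_ _) H.
  have {}H : (3 * (K * r n ^+ 2))^-1 <= (3 * (K * r n ^+ 2))^-1 `^ (q - 1) by apply: H; lra.
  have m0 : 0 <= 4 * r n * r n by rewrite !mulr_ge0 // ltW.
  have -> : 4 / (9 * K) = 3^-1 * (3 * (K * r n ^+ 2))^-1 * (4 * r n * r n).
    by field; rewrite !gt_eqF.
  by apply: ler_wpM2r => //; apply: ler_wpM2l; rewrite ?invr_ge0.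
Qed.

Lemma powR_four_three_quarters (x : R) : 0 < x ->
  ((x ^+ 4)^-1) `^ (7 / 4 - 1) = (x ^+ 3)^-1.
Proof.
move=> x0; have xV : 0 <= x^-1 by rewrite invr_ge0 ltW.
have -> : (x ^+ 4)^-1 = x^-1 `^ 4%:R by rewrite powR_mulrn // exprVn.
rewrite -powRrM; have -> : 4%:R * (7 / 4 - 1) = 3%:R :> R by field.
by rewrite powR_mulrn // exprVn.
Qed.

Lemma degenerate_case : B ^+ 2 = A * C -> exists h, [/\ 0 < h, h <= 1 &
  ~ (@leb3 R).-integrable (square h `*` Ipi) (kern u1 v1 u2 v2 (7 / 4))].
Proof.
move=> disc.
have [h [h0 h1 nearh]] := near_origin.
have [M [b [M0 bnd]]] := degenerate_bound D_ge0 defect0 disc.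
have n0 := N_gt0 0.
exists h; split=> //.
(* Makes [rho <= K * r ^+ 4]: on the parallelogram [D <= M * (2 * r ^+ 4)], and [N >= N 0 / 2]. *)
pose K := 4 * M / N 0 + 1.
have K1 : 1 <= K by rewrite lerDr divr_ge0 ?mulr_ge0 // ltW.
have K0 : 0 < K by lra.
(* The shear moves the second coordinate up to [|b| * r + r ^+ 2 <= (|b| + 1) * r], which must stay
   within [h]. *)
pose e := h / (`|b| + 1).
have b1 : 0 < `|b| + 1 by rewrite ltr_wpDl.
have e0 : 0 < e by rewrite divr_gt0.
have eb : e * (`|b| + 1) <= h by rewrite divfK // gt_eqF.
have eh : e <= h by rewrite ler_pdivrMr // ler_peMr ?(ltW h0) // lerDr.
pose r (n : nat) := e / n.+1%:R.
have r0 n : 0 < r n by rewrite divr_gt0.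
have re n : r n <= e by rewrite ler_pdivrMr // ler_peMr ?(ltW e0) // ler1n.
have r2 n : r n ^+ 2 <= r n.
  by rewrite expr2 ler_piMl ?(ltW (r0 n)) //; have := re n; lra.
have w0 t : square h t -> wre u1 v1 u2 v2 t < 0.
  by move=> /square_l1norm ht; have [] := nearh t ht.
have null : mu2 (square h `&` [set t | D t = 0]) = 0%E.
  by apply: square_null; have := pi_ge2 R; lra.
have Epos n : 0 < K * r n ^+ 4 by rewrite mulr_gt0 // exprn_gt0.
have k0 : 0 < 4 / 3 * (3 * K)^-1 `^ (7 / 4 - 1).
  by rewrite mulr_gt0 ?divr_gt0 // powR_gt0 // invr_gt0 mulr_gt0.
have kE n m : m = 4 * r n ^+ 3 -> 4 / 3 * (3 * K)^-1 `^ (7 / 4 - 1) <=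
    3^-1 * (3 * (K * r n ^+ 4))^-1 `^ (7 / 4 - 1) * m.
  move=> ->; have -> : (3 * (K * r n ^+ 4))^-1 = (3 * K)^-1 * (r n ^+ 4)^-1 by rewrite mulrA invfM.
  have K3 : 0 <= (3 * K)^-1 by rewrite invr_ge0 mulr_ge0 // ltW.
  have r4 : 0 <= (r n ^+ 4)^-1 by rewrite invr_ge0 exprn_ge0 // ltW.
  rewrite (powRM _ K3 r4) powR_four_three_quarters //; set X := _ `^ _.
  by rewrite le_eqVlt; apply/orP; left; apply/eqP; field; rewrite gt_eqF.
have rc : r @ \oo --> (0 : R) by exact: harmonic_scale_cvg.
have r2c : (fun n => r n ^+ 2) @ \oo --> (0 : R).
  by rewrite -[X in _ --> X](mulr0 (0 : R)); exact: (cvgM rc rc).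
have ratio n t x y : square h t -> D t <= M * (x ^+ 4 + y ^+ 2) -> `|x| < r n ->
    `|y| < r n ^+ 2 -> D t / N t <= K * r n ^+ 4.
  move=> /square_l1norm ht Dt xr yr; have [_ Nt] := nearh t ht.
  rewrite ler_pdivrMr //; apply: (le_trans Dt).
  have x4 : x ^+ 4 <= r n ^+ 4.
    have -> : x ^+ 4 = `|x| ^+ 4 by rewrite -normrX ger0_norm // exprn_even_ge0.
    by rewrite lerXn2r ?nnegrE // ltW.
  have y2 : y ^+ 2 <= r n ^+ 4.
    rewrite -real_normK ?num_real // [leRHS](exprM _ 2 2).
    by rewrite lerXn2r ?nnegrE ?sqr_ge0 // ltW.
  have r4 : 0 <= r n ^+ 4 by rewrite exprn_ge0 // ltW.
  apply: (@le_trans _ _ (M * (2 * r n ^+ 4))); first by apply: ler_wpM2l => //; lra.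
  apply: (@le_trans _ _ (K * r n ^+ 4 * (N 0 / 2))); last first.
    by apply: ler_wpM2l => //; rewrite ltW.
  have -> : K * r n ^+ 4 * (N 0 / 2) = M * (2 * r n ^+ 4) + r n ^+ 4 * (N 0 / 2).
    by rewrite /K; field; rewrite gt_eqF.
  by rewrite lerDl mulr_ge0 // divr_ge0 // ltW.
have q1 : 1 <= 7 / 4 :> R by lra.
have rr0 n : 0 < r n ^+ 2 by rewrite exprn_gt0.
case: bnd => bnd.
- have sub n : parallelogram b (r n) (r n ^+ 2) `<=` square h.
    move=> t [/= h3 h4]; split; rewrite /= in_itv /= -ltr_norml.
      by have := re n; lra.
    have : `|t.2| <= `|t.2 - b * t.1| + `|b| * `|t.1|.
      by rewrite -normrM -[in leLHS](subrK (b * t.1) t.2) ler_normD.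
    have := ler_wpM2l (normr_ge0 b) (ltW h3); have := r2 n; have := re n.
    have := ler_wpM2l (normr_ge0 b) (re n).
    by lra.
  apply: (@kern_not_integrable _ u1 v1 u2 v2 D_ge0 N_gt0 h (7 / 4) b _
    (fun n => K * r n ^+ 4) r (fun n => r n ^+ 2) h0 q1 w0 null Epos r0 rr0 rc r2c sub _ k0).
    move=> n [x y] St; apply: (ratio n _ x (y - b * x)); first exact: (sub n).
    + by have := bnd x (y - b * x); rewrite addrC subrK.
    + by case: St.
    + by case: St.
  by move=> n; apply: kE; ring.
(* The null direction is vertical: the long side lies along the second axis, so the radii trade
   places and there is no shear. *)
- have sub n : parallelogram 0 (r n ^+ 2) (r n) `<=` square h.
    move=> t [/= h3]; rewrite mul0r subr0 => h4.
    by split; rewrite /= in_itv /= -ltr_norml; have := re n; have := r2 n; lra.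
  apply: (@kern_not_integrable _ u1 v1 u2 v2 D_ge0 N_gt0 h (7 / 4) 0 _
    (fun n => K * r n ^+ 4) (fun n => r n ^+ 2) r h0 q1 w0 null Epos rr0 r0 r2c rc sub _ k0).
    move=> n [x y] St; apply: (ratio n _ y x); first exact: (sub n).
    + exact: bnd.
    + by case: St => _; rewrite /= mul0r subr0.
    + by case: St.
  by move=> n; apply: kE; ring.
Qed.

End LocalAnalysis.

(** * Divisibility in C[z1][z2][z3] *)

Section PolynomialDivisibility.
Local Open Scope ring_scope.

(** Applied twice, this lifts the factor theorem in [z1] to polynomials in three variables:
    evaluation at [c] kills exactly the multiples of [z1 - c]. *)
Lemma map_poly_eq0_dvd (S T : nzRingType) (f : {rmorphism S -> T}) (a : S) :
  (forall x, f x = 0 -> exists y, x = a * y) ->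
  forall p : {poly S}, map_poly f p = 0 -> exists q, p = a%:P * q.
Proof.
move=> fa; elim/poly_ind => [_|p c IH]; first by exists 0; rewrite mulr0.
rewrite rmorphD rmorphM /= map_polyX map_polyC /= => E.
have fc : f c = 0.
  by move: E => /(congr1 (fun r : {poly T} => r`_0)); rewrite coefD coefMX coefC coef0 add0r.
move: E; rewrite fc addr0 => E.
have /IH[q ->] : map_poly f p = 0.
  apply/polyP => i; move: E => /(congr1 (fun r : {poly T} => r`_i.+1)).
  by rewrite coefMX !coef0.
have [y ->] := fa _ fc.
by exists (q * 'X + y%:P); rewrite mulrDr mulrA polyCM.
Qed.

(* Gauss: each linear factor of r is a prime element, hence divides G or H. *)
Lemma gauss_split (F : closedFieldType) (B : idomainType)
    (e : {rmorphism {poly F} -> B}) :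
  injective e ->
  (forall (c : F) K G H, e ('X - c%:P) * K = G * H ->
     (exists G', G = e ('X - c%:P) * G') \/ (exists H', H = e ('X - c%:P) * H')) ->
  forall r G H K, r != 0 -> e r * K = G * H ->
  exists r1 r2 G' H', [/\ r = r1 * r2, G = e r1 * G', H = e r2 * H' & K = G' * H'].
Proof.
move=> einj eprime r; elim: {r}(size r) {-2}r (leqnn (size r)) => [|n IH] r.
  by rewrite leqn0 size_poly_eq0 => /eqP-> ? ? ?; rewrite eqxx.
move=> sr G H K r0 E.
have [sr1|] := eqVneq (size r) 1%N.
  have /size_poly1P[c c0 rc] : size r == 1%N by rewrite sr1.
  have ec : e c^-1%:P * e r = 1 by rewrite -rmorphM rc -polyCM mulVf // rmorph1.
  exists r, 1, (e c^-1%:P * G), H; split.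
  - by rewrite mulr1.
  - by rewrite mulrA [e r * _]mulrC ec mul1r.
  - by rewrite rmorph1 mul1r.
  - by rewrite -mulrA -E mulrA ec mul1r.
move=> /closed_rootP[c /factor_theorem[s rs]].
have s0 : s != 0 by apply: contra_neq r0 => s0; rewrite rs s0 mul0r.
have ss : (size s <= n)%N.
  by move: sr; rewrite rs size_Mmonic ?monicXsubC // size_XsubC addn2.
have l0 : e ('X - c%:P) != 0.
  by apply/eqP; rewrite -(rmorph0 e) => /einj/eqP; rewrite polyXsubC_eq0.
have : e ('X - c%:P) * (e s * K) = G * H by rewrite -E rs rmorphM; ring.
move=> /[dup] E' /eprime[] [G1 G1E].
- have /(IH s ss _ _ _ s0)[r1 [r2 [G2 [H2 [sE G2E H2E ->]]]]] : e s * K = G1 * H.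
    by apply: (mulfI l0); rewrite E' G1E mulrA.
  by exists (r1 * ('X - c%:P)), r2, G2, H2; split=> //;
    rewrite ?rs ?G1E ?sE ?G2E ?rmorphM; ring.
- have /(IH s ss _ _ _ s0)[r1 [r2 [G2 [H2 [sE G2E H2E ->]]]]] : e s * K = G * G1.
    by apply: (mulfI l0); rewrite E' G1E; ring.
  by exists r1, (r2 * ('X - c%:P)), G2, H2; split=> //;
    rewrite ?rs ?G1E ?sE ?H2E ?rmorphM; ring.
Qed.

Variable F : closedFieldType.

Definition polyC2 : {rmorphism {poly F} -> {poly {poly {poly F}}}} :=
  @polyC {poly {poly F}} \o @polyC {poly F}.

Definition inner_eval (c : F) : {rmorphism {poly {poly {poly F}}} -> {poly {poly F}}} :=
  map_poly (map_poly (horner_eval c)).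

Lemma inner_eval_eq0 c G : inner_eval c G = 0 ->
  exists H, G = polyC2 ('X - c%:P) * H.
Proof.
apply: map_poly_eq0_dvd; apply: map_poly_eq0_dvd => x /eqP.
by rewrite -[_ == 0]/(root x c) => /factor_theorem[q ->]; exists q; rewrite mulrC.
Qed.

Lemma polyC2_inj : injective polyC2.
Proof. by move=> x y /polyC_inj /polyC_inj. Qed.

(** Setting [z1 = c] lands in an integral domain, so one of the two factors is killed. *)
Lemma polyC2_XsubC_prime (c : F) K G H : polyC2 ('X - c%:P) * K = G * H ->
  (exists G', G = polyC2 ('X - c%:P) * G') \/
  (exists H', H = polyC2 ('X - c%:P) * H').
Proof.
move=> E; have : inner_eval c G * inner_eval c H = 0.
  have -> : inner_eval c G * inner_eval c H = inner_eval c (G * H).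
    by rewrite [RHS]rmorphM.
  rewrite -E rmorphM.
  have -> : inner_eval c (polyC2 ('X - c%:P)) = 0.
    rewrite /= !map_polyC /= map_polyC /=.
    by rewrite /horner_eval hornerXsubC subrr.
  by rewrite mul0r.
by move=> /eqP; rewrite mulf_eq0 => /orP[] /eqP /inner_eval_eq0; [left|right].
Qed.

(* The pairs (R, k) with p k = R p~ contain R = p1 and R = p2, hence by Bezout
   over C(z1)[z2] some nonzero R depending on z1 only; gauss_split then gives
   p | p~. *)
Lemma irreducible_dvd_proportional (p1 p2 q1 q2 : {poly {poly F}}) :
  let p := p1%:P + 'X * p2%:P in let q := 'X * q1%:P + q2%:P in
  p2 != 0 ->
  (forall G H, p = G * H -> G \is a GRing.unit \/ H \is a GRing.unit) ->
  q1 * p1 = q2 * p2 -> exists H, q = H * p.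
Proof.
move=> p q p20 irr E.
have coefp : p`_1 = p2 by rewrite /p coefD coefC coefXM coefC add0r.
have not_const (G : {poly {poly F}}) : p <> G%:P.
  by move=> pG; move: p20; rewrite -coefp pG coefC eqxx.
have unitC (G : {poly {poly {poly F}}}) : G \is a GRing.unit ->
    exists2 r, r != 0 & G = polyC2 r.
  rewrite poly_unitE => /andP[/eqP/eq_leq/size1_polyC->].
  rewrite poly_unitE coefC /= => /andP[/eqP s1].
  move: (s1) => /eq_leq/size1_polyC-> _.
  exists (G`_0`_0) => //; apply/eqP => e.
  by move: (s1); rewrite (size1_polyC (eq_leq s1)) e size_poly0.
have gauss := gauss_split polyC2_inj polyC2_XsubC_prime.
have cst_inj : injective (polyC : {poly {poly F}} -> _) := @polyC_inj _.
(* Division here holds up to factors in [z1]. [gauss_split] distributes these over the gcd and the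
   cofactor, which yields a true factorization of [p]; irreducibility makes one factor a unit. *)
have [g_const gn0 gE] : exists2 r, r != 0 & gcdp p1 p2 = r%:P.
  set g := gcdp p1 p2.
  have /Pdiv.Idomain.dvdpP[[c1 a] /= c10 E1] : g %| p1 by exact: dvdp_gcdl.
  have /Pdiv.Idomain.dvdpP[[c2 b] /= c20 E2] : g %| p2 by exact: dvdp_gcdr.
  have c0 : c1 * c2 != 0 by rewrite mulf_neq0.
  have : polyC2 (c1 * c2) * p = g%:P * ((c2%:P * a)%:P + 'X * (c1%:P * b)%:P).
    move: E1 E2; rewrite -!mul_polyC => E1 E2.
    rewrite /polyC2 /p /= mulrDr [_ * ('X * _)]mulrCA -!polyCM.
    rewrite mulrDr [_ * ('X * _)]mulrCA -!polyCM; congr (_%:P + 'X * _%:P).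
      transitivity (c2%:P * (c1%:P * p1)); first by rewrite polyCM; ring.
      by rewrite E1; ring.
    transitivity (c1%:P * (c2%:P * p2)); first by rewrite polyCM; ring.
    by rewrite E2; ring.
  move=> /(gauss _ _ _ _ c0)[r1 [r2 [G [H [rE gE aE /irr[] /unitC[u u0 ue]]]]]].
    exists (r1 * u).
      by rewrite mulf_neq0 //; apply: contra_neq c0 => r10; rewrite rE r10 mul0r.
    by apply: cst_inj; rewrite gE ue -rmorphM.
  (* If the cofactor is the unit, it does not involve [z3]; its [z3]-coefficient vanishes, and
     [p2 = 0] follows. *)
  move: aE; rewrite ue -rmorphM => /(congr1 (fun r : {poly {poly {poly F}}} => r`_1)).
  rewrite coefD coefC coefXM !coefC /= add0r => /eqP.
  rewrite mulf_eq0 polyC_eq0 => /orP[/eqP c10'|/eqP b0].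
    by rewrite c10' eqxx in c10.
  move/eqP: E2; rewrite b0 mul0r -mul_polyC mulf_eq0 polyC_eq0 (negbTE c20).
  by rewrite (negbTE p20).
have [[u v] /= /eqpP[[d1 d2] /= /andP[d10 d20]]] := Bezoutp p1 p2.
rewrite gE -!mul_polyC -polyCM => Bz.
have R0 : d2 * g_const != 0 by rewrite mulf_neq0.
(* The relation [E] gives [p * q2 = p1 * q] and [p * q1 = p2 * q]; these are combined with the
   Bezout coefficients. *)
have : polyC2 (d2 * g_const) * q = p * (d1%:P * (u * q2 + v * q1))%:P.
  rewrite /polyC2 /= -Bz /p /q.
  rewrite mulrDr [_ * ('X * _)]mulrCA -!polyCM.
  rewrite mulrDl -['X * _ * _]mulrA -!polyCM addrC.
  congr (_%:P + 'X * _%:P).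
    transitivity (d1%:P * (u * p1 * q2 + v * (q2 * p2))); first by ring.
    by rewrite -E; ring.
  transitivity (d1%:P * (u * (q1 * p1) + v * p2 * q1)); first by ring.
  by rewrite E; ring.
move=> /(gauss _ _ _ _ R0)[r1 [r2 [G [H [_ pE _ ->]]]]].
(* A unit [G] would make [p] a polynomial in [z1] alone, against [p2 != 0]. *)
have [] := irr _ _ pE; last first.
  by move=> /unitC[w _ wE]; case: (not_const (r1%:P * w%:P)); rewrite pE wE polyCM.
move=> u1; exists ((polyC2 r1)^-1 * H).
by rewrite pE mulrACA mulVr // mul1r mulrC.
Qed.

End PolynomialDivisibility.

(** * Taylor coefficients of a quotient at a zero minimum *)

Section Quotient.
Variable R : realType.
Implicit Types (e f : trig R) (v : R * R).

Definition quot_num v e f : trig R :=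
  TAdd (TMul (tdir v e) f) (TMul (TCst (-1)) (TMul e (tdir v f))).

Lemma is_derive_quot e f a v : (forall t, teval f t != 0) ->
  is_derive a v (fun t => teval e t / teval f t)
    (teval (quot_num v e f) a / teval (TMul f f) a).
Proof.
move=> f0; have de := is_derive_teval e a v; have df := is_derive_teval f a v.
have dV : is_derive a v (fun t => (teval f t)^-1) (- (teval f a) ^- 2 *: teval (tdir v f) a).
  split; first exact: derivableV.
  by rewrite deriveV // derive_val.
apply: (is_derive_eq (is_deriveM de dV)).
by have := f0 a; rewrite /GRing.scale /= => fa; field.
Qed.

(** Where the numerator vanishes to first order, every term that differentiates the denominator
    drops out. *)
Lemma derive2_quot e f v w : (forall t, teval f t != 0) -> teval e 0 = 0 ->
  (forall v, teval (tdir v e) 0 = 0) ->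
  derive (fun a => derive (fun t => teval e t / teval f t) a v) 0 w =
  teval (tdir w (tdir v e)) 0 / teval f 0.
Proof.
move=> f0 e0 de0.
have -> : (fun a => derive (fun t => teval e t / teval f t) a v) =
    (fun a => teval (quot_num v e f) a / teval (TMul f f) a).
  by apply/funext => a; have /@derive_val := is_derive_quot e a v f0.
have f20 t : teval (TMul f f) t != 0 by rewrite /= mulf_neq0.
have /@derive_val -> := is_derive_quot (quot_num v e f) 0 w f20.
have fz := f0 0.
have d1 : teval (td1 e) 0 = 0 by have := de0 (1, 0); rewrite /=; lra.
have d2 : teval (td2 e) 0 = 0 by have := de0 (0, 1); rewrite /=; lra.
by rewrite /= d1 d2 e0; field.
Qed.

(** With [n] the value of [f] at 0, the coefficients are [c20 = A / (2 n)], [c02 = C / (2 n)] and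
    [c11 = B / n], so [n] cancels from the condition. [A] and [C] are nonnegative at a minimum, so
    the square root is a genuine one. *)
Lemma quot_coeffs (e f : trig R) (r := fun t => teval e t / teval f t) :
  (forall t, 0 <= teval e t) -> teval e 0 = 0 -> (forall t, 0 < teval f t) ->
  (c11 r = 2 * Num.sqrt (c02 r * c20 r) \/
   c11 r = - (2 * Num.sqrt (c02 r * c20 r))) <->
  teval (td1 (td2 e)) 0 ^+ 2 = teval (td1 (td1 e)) 0 * teval (td2 (td2 e)) 0.
Proof.
move=> e_ge0 e0 f_gt0.
have f0 t : teval f t != 0 by rewrite gt_eqF.
have D2 v w := derive2_quot v w f0 e0 (min_grad e_ge0 e0).
have [A0 C0 _] := min_hess_disc e_ge0 e0.
rewrite /c11 /c02 /c20 /r -[(0, 0)]/(0 : R * R) !D2.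
set A := teval (td1 (td1 e)) 0 in A0 *; set C := teval (td2 (td2 e)) 0 in C0 *.
set B := teval (td1 (td2 e)) 0.
have -> : teval (tdir (1, 0) (tdir (0, 1) e)) 0 = B by rewrite /= -/B; ring.
have -> : teval (tdir (0, 1) (tdir (0, 1) e)) 0 = C by rewrite /= -/C; ring.
have -> : teval (tdir (1, 0) (tdir (1, 0) e)) 0 = A by rewrite /= -/A; ring.
have := f_gt0 0; set n := teval f 0 => n0.
have n1 : n != 0 by rewrite gt_eqF.
set s := Num.sqrt _.
have sE : s ^+ 2 = A * C / (4 * n ^+ 2).
  rewrite sqr_sqrtr; last by rewrite mulr_ge0 // !divr_ge0 // ltW.
  by field.
have EE : B ^+ 2 = A * C <-> (B / n) ^+ 2 = (2 * s) ^+ 2.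
  rewrite [(2 * s) ^+ 2]exprMn sE; split=> [E|/(congr1 (fun x => x * n ^+ 2))].
    by rewrite expr_div_n E; field.
  have -> : (B / n) ^+ 2 * n ^+ 2 = B ^+ 2 by field.
  by move=> ->; field.
by rewrite EE; split=> [[] ->|/eqP]; rewrite ?sqrrN // eqf_sqr => /orP[] /eqP; [left|right].
Qed.

End Quotient.

(** * Polynomials on the torus *)

Section CircleFacts.
Variable R : realType.
Local Notation C := R[i].

Lemma cabs_sqr (z : C) : cabs z ^+ 2 = complex.Re z ^+ 2 + complex.Im z ^+ 2.
Proof. by case: z => a b; rewrite /cabs /= sqr_sqrtr // addr_ge0 ?sqr_ge0. Qed.

Lemma cabs_ge0 (z : C) : 0 <= cabs z.
Proof. by case: z => a b; exact: sqrtr_ge0. Qed.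

Lemma cabsM (z w : C) : cabs (z * w) = cabs z * cabs w.
Proof. exact: ComplexField.Normc.normcM. Qed.

Lemma cabsV (z : C) : cabs z^-1 = (cabs z)^-1.
Proof. exact: ComplexField.Normc.normcV. Qed.

Lemma cabsX (z : C) n : cabs (z ^+ n) = cabs z ^+ n.
Proof.
elim: n => [|n IH]; first by rewrite !expr0 /cabs ComplexField.Normc.normc1.
by rewrite !exprS cabsM IH.
Qed.

Lemma cabs_conj (z : C) : cabs (conjc z) = cabs z.
Proof. by case: z => a b; rewrite /cabs /= sqrrN. Qed.

Lemma cabsN (z : C) : cabs (- z) = cabs z.
Proof. by case: z => a b; rewrite /cabs /= !sqrrN. Qed.

Lemma cabs_expi (t : R) : cabs (expi t) = 1.
Proof. by rewrite /cabs /expi /= cos2Dsin2 sqrtr1. Qed.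

Lemma expi_conj (t : R) : expi t * conjc (expi t) = 1.
Proof.
apply/eqP; rewrite eq_complex /=; apply/andP; split; apply/eqP; last by ring.
by rewrite mulrN opprK -!expr2 cos2Dsin2.
Qed.

Lemma expi0 : expi (0 : R) = 1.
Proof. by rewrite /expi cos0 sin0. Qed.

Lemma expi_inj (x y : R) : -pi < x < pi -> -pi < y < pi -> expi x = expi y -> x = y.
Proof.
move=> hx hy [c s].
have ax : `|x| \in `[0, pi]%R.
  by rewrite in_itv /= normr_ge0 ler_norml; move/andP: hx => [h1 h2]; rewrite !ltW.
have ay : `|y| \in `[0, pi]%R.
  by rewrite in_itv /= normr_ge0 ler_norml; move/andP: hy => [h1 h2]; rewrite !ltW.
have cabsr (z : R) : cos `|z| = cos z.
  by case: (ger0P z) => z0; rewrite ?cosN.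
have : `|x| = `|y| by apply: (cos_inj ax ay); rewrite !cabsr.
move=> /eqP; rewrite eqr_norm2 => /orP[/eqP //|/eqP xy].
have sy : sin y = 0 by move: s; rewrite xy sinN; lra.
have [y0|y0|y0] := ltgtP y 0.
- have : 0 < sin (- y) by apply: sin_gt0_pi; move/andP: hy => [h1 h2]; apply/andP; split; lra.
  by rewrite sinN sy oppr0 ltxx.
- have : 0 < sin y by apply: sin_gt0_pi; move/andP: hy => [h1 h2]; apply/andP; split; lra.
  by rewrite sy ltxx.
- by rewrite xy y0 oppr0.
Qed.

Lemma finite_roots_expi (c : {poly C}) : c != 0 ->
  finite_set [set x : R | -pi < x < pi /\ root c (expi x)].
Proof.
move=> c0.
pose g (z : C) : R := xget 0 [set x | -pi < x < pi /\ expi x = z].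
have [rs rsE] := closed_field_poly_normal c.
apply: (@sub_finite_set _ _ (g @` [set` rs])); last by apply: finite_image; exact: finite_seq.
move=> x [xpi cx]; exists (expi x).
  move: cx; rewrite rsE rootZ ?lead_coef_eq0 // root_prod_XsubC.
  by [].
rewrite /g; case: xgetP => [y _ [ypi yx]|/(_ x)]; first exact: expi_inj.
by case.
Qed.

End CircleFacts.

Section Reflection.
Variable R : realType.
Local Notation C := R[i].
Implicit Types (q : {poly {poly C}}) (m n : nat).

Lemma eval2_sum m n q (z1 z2 : C) : bideg_le m n q ->
  eval2 q z1 z2 = \sum_(j < n.+1) \sum_(i < m.+1) q`_j`_i * z1 ^+ i * z2 ^+ j.
Proof.
move=> [sq sqj]; rewrite /eval2 (@horner_coef_wide _ n.+1); last first.
  exact: leq_trans (size_poly _ _) sq.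
apply: eq_bigr => j _.
rewrite (coef_map (horner_eval z1)) /= /horner_eval (@horner_coef_wide _ m.+1) //.
by rewrite mulr_suml.
Qed.

(** On the torus the conjugate of [z] is its inverse; reversing both summation indices turns the
    conjugated sum into that of the reflection. *)
Lemma eval2_refl m n q (x y : R) : bideg_le m n q ->
  eval2 (refl2 m n q) (expi x) (expi y) =
  expi x ^+ m * expi y ^+ n * conjc (eval2 q (expi x) (expi y)).
Proof.
move=> bq.
have br : bideg_le m n (refl2 m n q).
  split=> [|j]; first exact: size_poly.
  by rewrite coef_poly; case: ifP => _; rewrite ?size_poly0 //; exact: size_poly.
rewrite (eval2_sum _ _ br) (eval2_sum _ _ bq) rmorph_sum mulr_sumr.
rewrite (reindex_inj rev_ord_inj) /=; apply: eq_bigr => j _.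
rewrite rmorph_sum mulr_sumr (reindex_inj rev_ord_inj) /=; apply: eq_bigr => i _.
have jn : (j <= n)%N by rewrite -ltnS.
have im : (i <= m)%N by rewrite -ltnS.
rewrite !subSS coef_poly ltnS leq_subr coef_poly ltnS leq_subr !subKn //.
rewrite !rmorphM !rmorphXn /=.
have ex := expi_conj x; have ey := expi_conj y.
have -> : expi x ^+ m = expi x ^+ (m - i) * expi x ^+ i by rewrite -exprD subnK.
have -> : expi y ^+ n = expi y ^+ (n - j) * expi y ^+ j by rewrite -exprD subnK.
have e1 : expi x ^+ i * conjc (expi x) ^+ i = 1 by rewrite -exprMn ex expr1n.
have e2 : expi y ^+ j * conjc (expi y) ^+ j = 1 by rewrite -exprMn ey expr1n.
set c := conjc _.
transitivity (c * expi x ^+ (m - i) * expi y ^+ (n - j) *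
  (expi x ^+ i * conjc (expi x) ^+ i) * (expi y ^+ j * conjc (expi y) ^+ j)).
  by rewrite e1 e2 !mulr1.
ring.
Qed.

Lemma eval3_lin (a b : {poly {poly C}}) z1 z2 z3 :
  eval3 (a%:P + 'X * b%:P) z1 z2 z3 = eval2 a z1 z2 + z3 * eval2 b z1 z2.
Proof.
pose ev : {rmorphism {poly {poly C}} -> C} :=
  horner_eval z2 \o map_poly (horner_eval z1).
rewrite /eval3 -[map_poly _ _]/(map_poly ev _) rmorphD rmorphM /= map_polyX !map_polyC /=.
by rewrite hornerD hornerM hornerX !hornerC.
Qed.

Lemma pol3E (p1 p2 : {poly {poly C}}) z1 z2 z3 :
  eval3 (pol3 p1 p2) z1 z2 z3 = eval2 p1 z1 z2 + z3 * eval2 p2 z1 z2.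
Proof. exact: eval3_lin. Qed.

Lemma pol3_reflE m n (p1 p2 : {poly {poly C}}) z1 z2 z3 :
  eval3 (pol3_refl m n p1 p2) z1 z2 z3 =
  z3 * eval2 (refl2 m n p1) z1 z2 + eval2 (refl2 m n p2) z1 z2.
Proof. by rewrite /pol3_refl addrC eval3_lin addrC. Qed.

Lemma eval3_deriv (a b : {poly {poly C}}) z1 z2 z3 :
  eval3 (deriv (a%:P + 'X * b%:P)) z1 z2 z3 = eval2 b z1 z2.
Proof.
rewrite derivD derivM derivX !derivC mulr0 addr0 add0r mul1r.
have -> : b%:P = b%:P + 'X * 0%:P by rewrite polyC0 mulr0 addr0.
by rewrite eval3_lin eval2_0 mulr0 addr0.
Qed.

(* p has no zero in the tridisk, so |p2| <= |p1| in the bidisk; the bound is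
   transported to the torus along the radius through the point. *)
Lemma torus_domination (p1 p2 : {poly {poly C}}) (x y : R) :
  (forall z1 z2 z3 : C, cabs z1 < 1 -> cabs z2 < 1 -> cabs z3 < 1 ->
     eval3 (pol3 p1 p2) z1 z2 z3 != 0) ->
  cabs (eval2 p2 (expi x) (expi y)) <= cabs (eval2 p1 (expi x) (expi y)).
Proof.
move=> nz.
have bidisk z1 z2 : cabs z1 < 1 -> cabs z2 < 1 ->
    cabs (eval2 p2 z1 z2) <= cabs (eval2 p1 z1 z2).
  move=> h1 h2; rewrite leNgt; apply/negP => lt12.
  have p20 : 0 < cabs (eval2 p2 z1 z2) := le_lt_trans (cabs_ge0 _) lt12.
  have p2n : eval2 p2 z1 z2 != 0.
    by apply: contraTneq p20 => ->; rewrite /cabs ComplexField.Normc.normc0 ltxx.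
  (* This value of [z3] solves [p1 + z3 p2 = 0], and it would lie in the disk. *)
  have := nz z1 z2 (- (eval2 p1 z1 z2 / eval2 p2 z1 z2)) h1 h2.
  rewrite pol3E mulNr divfK // subrr eqxx => H.
  suff /H : cabs (- (eval2 p1 z1 z2 / eval2 p2 z1 z2)) < 1 by [].
  by rewrite cabsN cabsM cabsV ltr_pdivrMr // mul1r.
pose S (f : R -> R) := exists P : {poly R}, f = horner P.
have ray q : exists P Q : {poly R}, forall s : R,
    eval2 q (Complex (s * cos x) (s * sin x)) (Complex (s * cos y) (s * sin y))
    = Complex P.[s] Q.[s].
  have lin c : S (fun s => s * c).
    by exists (c *: 'X); apply/funext => s; rewrite hornerZ hornerX mulrC.
  have [|||f [g [[P ->] [Q ->] E]]] := @eval2_closed R _ S _ _ _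
    _ _ _ _ (lin (cos x)) (lin (sin x)) (lin (cos y)) (lin (sin y)) q.
  - by move=> c; exists c%:P; apply/funext => s; rewrite hornerC.
  - by move=> _ _ [P ->] [Q ->]; exists (P + Q); apply/funext => s; rewrite hornerD.
  - by move=> _ _ [P ->] [Q ->]; exists (P * Q); apply/funext => s; rewrite hornerM.
  by exists P, Q.
have [P1 [Q1 E1]] := ray p1; have [P2 [Q2 E2]] := ray p2.
(* Along the radius |p1|^2 - |p2|^2 is a real polynomial in [s], nonnegative for [0 <= s < 1] and
   hence at 1 by continuity. *)
pose G := P1 ^+ 2 + Q1 ^+ 2 - (P2 ^+ 2 + Q2 ^+ 2).
have GE s : G.[s] = cabs (eval2 p1 (Complex (s * cos x) (s * sin x)) (Complex (s * cos y) (s * sin y))) ^+ 2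
    - cabs (eval2 p2 (Complex (s * cos x) (s * sin x)) (Complex (s * cos y) (s * sin y))) ^+ 2.
  by rewrite E1 E2 !cabs_sqr /= /G !hornerE.
have Gge s : 0 <= s -> s < 1 -> 0 <= G.[s].
  move=> s0 s1; rewrite GE subr_ge0 lerXn2r ?nnegrE ?cabs_ge0 //.
  have sm a : cabs (Complex (s * cos a) (s * sin a)) < 1.
    rewrite /cabs /= !exprMn -mulrDr cos2Dsin2 mulr1 sqrtr_sqr ger0_norm //.
  exact: bidisk.
have : 0 <= G.[1].
  rewrite leNgt; apply/negP => G1.
  have e0 : 0 < - G.[1] by rewrite oppr_gt0.
  have [d d0 Gd] := polyrcf.poly_cont 1 G e0.
  pose s := 1 - Num.min (d / 2) 1.
  have m0 : 0 < Num.min (d / 2) 1 by rewrite lt_min ltr01 divr_gt0.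
  have m1 : Num.min (d / 2) 1 <= 1 by rewrite ge_min lexx orbT.
  have md : Num.min (d / 2) 1 <= d / 2 by rewrite ge_min lexx.
  have := Gd s; rewrite /s addrAC subrr add0r normrN gtr0_norm // -/s => Gs.
  have {Gs} : `|G.[s] - G.[1]| < - G.[1] by apply: Gs; lra.
  rewrite ltr_norml => /andP[_ h].
  have : 0 <= G.[s] by apply: Gge; rewrite /s; lra.
  lra.
by rewrite GE subr_ge0 !mul1r ler_pXn2r ?nnegrE ?cabs_ge0.
Qed.

End Reflection.

(** * From the inner function to the kernel *)

Section InnerFunction.
Variable R : realType.
Local Notation C := R[i].
Local Notation mu := (@lebesgue_measure R).
Local Notation Ipi := (`](- pi)%R, (pi : R)[%classic).
Variables (m n : nat) (p1 p2 : {poly {poly C}}) (u1 v1 u2 v2 : trig R).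
Hypotheses (deg1 : bideg_le m n p1) (deg2 : bideg_le m n p2).
Hypotheses
  (ev1 : forall t, eval2 p1 (expi t.1) (expi t.2) = Complex (teval u1 t) (teval v1 t))
  (ev2 : forall t, eval2 p2 (expi t.1) (expi t.2) = Complex (teval u2 t) (teval v2 t)).
Local Notation D := (teval (defect u1 v1 u2 v2)).
Local Notation N := (teval (modsq u1 v1)).
Hypotheses (D_ge0 : forall t, 0 <= D t) (N_gt0 : forall t, 0 < N t).

Lemma refl_defect t :
  eval2 (refl2 m n p1) (expi t.1) (expi t.2) * eval2 p1 (expi t.1) (expi t.2) -
  eval2 (refl2 m n p2) (expi t.1) (expi t.2) * eval2 p2 (expi t.1) (expi t.2) =
  expi t.1 ^+ m * expi t.2 ^+ n * Complex (D t) 0.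
Proof.
rewrite !eval2_refl // !ev1 !ev2 -!mulrA -!mulrBr; do 2!congr (_ * _).
by apply/eqP; rewrite eq_complex /=; apply/andP; split; apply/eqP; ring.
Qed.

Lemma cabs_unimod (t : R * R) : cabs (expi t.1 ^+ m * expi t.2 ^+ n) = 1.
Proof. by rewrite cabsM !cabsX !cabs_expi !expr1n mulr1. Qed.

Lemma rhoE : rho m n p1 p2 = fun t => D t / N t.
Proof.
apply/funext => t; rewrite /rho /psi0 cabsN cabsM cabsV.
rewrite !eval2_refl // ![cabs (expi t.1 ^+ m * _ * _)]cabsM cabs_unimod !mul1r !cabs_conj.
rewrite exprMn exprVn !cabs_sqr ev1 ev2 /=.
have := N_gt0 t; rewrite /= => n0.
by field; rewrite gt_eqF // !expr2.
Qed.

(** The equality holds at zeros of [p] too, where the quotients on both sides are 0 by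
    convention. *)
Lemma cabs_dphi (q : R) (x : (R * R) * R) :
  (cabs (dphi_dz3 m n p1 p2 (expi x.1.1) (expi x.1.2) (expi x.2)) `^ q)%:E =
  kern u1 v1 u2 v2 q x.
Proof.
rewrite /kern; congr ((_ `^ _)%:E).
rewrite /dphi_dz3 pol3E pol3_reflE /pol3 /pol3_refl eval3_deriv.
rewrite [X in deriv X]addrC eval3_deriv.
set a := eval2 p1 _ _; set b := eval2 p2 _ _; set z := expi x.2.
set ra := eval2 (refl2 m n p1) _ _; set rb := eval2 (refl2 m n p2) _ _.
have -> : ra * (a + z * b) - (z * ra + rb) * b = ra * a - rb * b by ring.
rewrite refl_defect cabsM cabsV cabsM cabs_unimod mul1r cabsX; congr (_ / _).
  by rewrite /cabs /= expr0n /= addr0 sqrtr_sqr ger0_norm // D_ge0.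
rewrite cabs_sqr /a /b ev1 ev2 /kden /=; ring.
Qed.

Lemma in_Lp_kern (h q : R) : in_Lp_VxT (dphi_dz3 m n p1 p2) (square h) q <->
  (@leb3 R).-integrable (square h `*` Ipi) (kern u1 v1 u2 v2 q).
Proof.
rewrite /in_Lp_VxT.
have -> : [set x : R * R * R | square h (x.1.1, x.1.2) /\ -pi < x.2 < pi] = square h `*` Ipi.
  by apply/seteqP; split=> -[[x y] z] /= [s zI]; split=> //; move: zI; rewrite /= in_itv.
have -> : (fun x : R * R * R =>
    (cabs (dphi_dz3 m n p1 p2 (expi x.1.1) (expi x.1.2) (expi x.2)) `^ q)%:E) =
    kern u1 v1 u2 v2 q.
  by apply/funext => x; exact: cabs_dphi.
by [].
Qed.

Lemma square_angle_nbhd h : 0 < h -> h <= 1 -> angle_nbhd (@square R h).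
Proof.
move=> h0 h1; have pi2 := pi_ge2 R; split; last split.
- have o : open (`](- h)%R, h[%classic : set R) by exact: interval_open.
  have -> : square h = (fst @^-1` `](- h)%R, h[%classic) `&` (snd @^-1` `](- h)%R, h[%classic).
    by apply/seteqP; split=> t /=.
  by apply: openI; apply: open_comp => // t _; [exact: cvg_fst | exact: cvg_snd].
- by split; rewrite /= in_itv /=; lra.
- by move=> t [] /=; rewrite !in_itv /= => /andP[a1 a2] /andP[a3 a4]; split; lra.
Qed.

(** D vanishes on the torus exactly where the nonzero polynomial [T] does. Outside the finitely many
    angles [x] at which the leading coefficient of [T] in [z2] vanishes, [T] is a nonzero polynomial
    in [z2] and has finitely many roots. *)
Lemma defect_null : refl2 m n p1 * p1 != refl2 m n p2 * p2 ->
  (mu \x mu)%E (square pi `&` [set t | D t = 0]) = 0%E.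
Proof.
rewrite -subr_eq0; set T := _ - _ => T0.
have TE t : eval2 T (expi t.1) (expi t.2) = expi t.1 ^+ m * expi t.2 ^+ n * Complex (D t) 0.
  rewrite -refl_defect /T.
  pose ev : {rmorphism {poly {poly C}} -> C} :=
    horner_eval (expi t.2) \o map_poly (horner_eval (expi t.1)).
  by rewrite -[eval2 _ _ _]/(ev (_ - _)) rmorphB !rmorphM.
pose X := [set x : R | -pi < x < pi /\ root (lead_coef T) (expi x)].
have fX : finite_set X by apply: finite_roots_expi; rewrite lead_coef_eq0.
apply: (@null_of_finite_sections _ _ X) => //.
  apply: measurableI; first exact: measurable_square.
  rewrite -[X in measurable X]setTI.
  exact: (measurable_teval _ measurableT (measurable_set1 0)).
move=> x nX.
have [xpi|xpi] := boolP (-pi < x < pi); last first.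
  apply: (@sub_finite_set _ _ set0) => // y; rewrite /xsection /= inE /=.
  by move=> [[] /=]; rewrite in_itv /= (negbTE xpi).
pose c := map_poly (horner_eval (expi x)) T.
have c0 : c != 0.
  apply/eqP => c0; apply: nX; split=> //.
  by rewrite /root -[_.[_]]/(horner_eval (expi x) T`_(size T).-1) -coef_map -/c c0 coef0.
apply: (sub_finite_set _ (finite_roots_expi c0)) => y.
rewrite /xsection /= inE /= => -[[_ /=]]; rewrite in_itv /= => ypi Dxy; split=> //.
have D0 : D (x, y) = 0 := Dxy.
have := TE (x, y); rewrite D0 -[Complex 0 0]/(0 : C) mulr0 /= => xy0.
by apply/eqP; exact: xy0.
Qed.

End InnerFunction.

Unset Implicit Arguments.

Theorem theorem3p12 (R : realType) (m n : nat) (p1 p2 : {poly {poly R[i]}}) :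
  (* p = p1 + z3 p2 has degree at most (m,n,1) *)
  bideg_le m n p1 -> bideg_le m n p2 ->
  (* p has no zeros on the tridisk *)
  (forall z1 z2 z3 : R[i], cabs z1 < 1 -> cabs z2 < 1 -> cabs z3 < 1 ->
     eval3 (pol3 p1 p2) z1 z2 z3 != 0) ->
  (* p and p~ have no common (non-unit) factor *)
  (forall q : {poly {poly {poly R[i]}}},
     (exists r, pol3 p1 p2 = r * q) -> (exists r, pol3_refl m n p1 p2 = r * q) ->
     q \is a GRing.unit) ->
  (* phi is irreducible: p is an irreducible polynomial *)
  (pol3 p1 p2 \isn't a GRing.unit /\
   forall q r : {poly {poly {poly R[i]}}}, pol3 p1 p2 = q * r ->
     q \is a GRing.unit \/ r \is a GRing.unit) ->
  (* Z(p~) /\ T^3 contains no vertical line {(zeta1,zeta2)} x T *)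
  ~ (exists zeta1 zeta2 : R[i], onT zeta1 /\ onT zeta2 /\
       forall zeta3, onT zeta3 -> eval3 (pol3_refl m n p1 p2) zeta1 zeta2 zeta3 = 0) ->
  (* singularity at (1,1,1) *)
  eval3 (pol3 p1 p2) 1 1 1 = 0 ->
  let r := rho m n p1 p2 in
  let s := Num.sqrt (c02 r * c20 r) in
  ((c11 r != 2 * s /\ c11 r != - (2 * s)) ->
     exists V, angle_nbhd V /\
       forall q : R, 1 <= q ->
         (in_Lp_VxT (dphi_dz3 m n p1 p2) V q <-> q < 2))
  /\
  ((c11 r = 2 * s \/ c11 r = - (2 * s)) ->
     exists V, angle_nbhd V /\
       exists q : R, 1 <= q /\ q < 2 /\ ~ in_Lp_VxT (dphi_dz3 m n p1 p2) V q).
Proof.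
move=> deg1 deg2 nz coprime [not_unit irr] no_line sing.
have [u1 [v1 ev1]] := eval2_teval p1; have [u2 [v2 ev2]] := eval2_teval p2.
have D_ge0 t : 0 <= teval (defect u1 v1 u2 v2) t.
  have := torus_domination t.1 t.2 nz.
  rewrite -(@ler_pXn2r _ 2) ?nnegrE ?cabs_ge0 // !cabs_sqr ev1 ev2 /= !expr2; lra.
have N_gt0 t : 0 < teval (modsq u1 v1) t.
  have NE : teval (modsq u1 v1) t = cabs (eval2 p1 (expi t.1) (expi t.2)) ^+ 2.
    by rewrite cabs_sqr ev1 /= !expr2.
  (* A zero of [p1] on the torus is by domination a zero of [p2]; both reflections vanish there as
     well, and p~ vanishes for every [z3]. *)
  rewrite lt_neqAle NE sqr_ge0 andbT eq_sym; apply/eqP => p10; apply: no_line.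
  have {}p10 : cabs (eval2 p1 (expi t.1) (expi t.2)) = 0.
    by apply/eqP; rewrite -sqrf_eq0 p10.
  have p20 : cabs (eval2 p2 (expi t.1) (expi t.2)) = 0.
    apply/eqP; rewrite eq_le cabs_ge0 andbT -p10; exact: torus_domination.
  exists (expi t.1), (expi t.2); rewrite /onT !cabs_expi; do 2!split=> //.
  move=> z _; rewrite pol3_reflE !eval2_refl //.
  rewrite (ComplexField.Normc.eq0_normc p10) (ComplexField.Normc.eq0_normc p20).
  by rewrite rmorph0 !mulr0 addr0.
have ev10 := ev1 0; have ev20 := ev2 0; rewrite /= !expi0 in ev10 ev20.
have [u0 v0] : teval u2 0 = - teval u1 0 /\ teval v2 0 = - teval v1 0.
  by move: sing; rewrite pol3E mul1r ev10 ev20 => -[]; lra.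
(* With [p2 = 0] the singularity would force [p1] to vanish at (1,1), against [N_gt0]. *)
have p20 : p2 != 0.
  apply/eqP => p20; have := N_gt0 0; rewrite /=.
  move: ev20 u0 v0; rewrite p20 eval2_0 => -[<- <-] /eqP; rewrite eq_sym oppr_eq0 => /eqP ->.
  by move=> /eqP; rewrite eq_sym oppr_eq0 => /eqP ->; rewrite mulr0 addr0 ltxx.
have null : (lebesgue_measure \x lebesgue_measure)%E
    (square pi `&` [set t | teval (defect u1 v1 u2 v2) t = 0]) = 0%E.
  apply: (defect_null deg1 deg2 ev1 ev2); apply/eqP => E.
  have [H HE] := irreducible_dvd_proportional p20 irr E.
  (* Here [p] itself is the common factor of [p] and p~. *)
  by move/negP: not_unit; apply; apply: coprime; [exists 1; rewrite mul1r | exists H].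
have e0 : teval (defect u1 v1 u2 v2) 0 = 0 by exact: defect0.
move=> r s; have rE : r = fun t => _ := rhoE deg1 deg2 ev1 ev2 N_gt0.
have coeffs := quot_coeffs D_ge0 e0 N_gt0; rewrite -rE in coeffs.
have [_ _ disc] := min_hess_disc D_ge0 e0.
split=> [[c1 c2]|c].
- have disc' : teval (td1 (td2 (defect u1 v1 u2 v2))) 0 ^+ 2 <
      teval (td1 (td1 (defect u1 v1 u2 v2))) 0 * teval (td2 (td2 (defect u1 v1 u2 v2))) 0.
    rewrite lt_neqAle disc andbT; apply/eqP => /coeffs.2[] c.
      by rewrite c eqxx in c1.
    by rewrite c eqxx in c2.
  have [h [h0 h1 hq]] := definite_case D_ge0 N_gt0 u0 v0 null disc'.
  exists (square h); split; first exact: square_angle_nbhd.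
  by move=> q q1; rewrite (in_Lp_kern deg1 deg2 ev1 ev2 D_ge0); exact: hq.
- have [h [h0 h1 hq]] := degenerate_case D_ge0 N_gt0 u0 v0 null (coeffs.1 c).
  exists (square h); split; first exact: square_angle_nbhd.
  exists (7 / 4); split; first lra; split; first lra.
  by move/(in_Lp_kern deg1 deg2 ev1 ev2 D_ge0).
Qed.
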